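(* Let $SO(n)=SO(n,\mathbb R)$ act by conjugation on the space $S(n)$ of real symmetric $n\times n$ matrices, and let $t\mapsto A'+t\alpha'$ be a straight line in $S(n)$. Then the ordered set of eigenvalues $a_1(t),\dots,a_n(t)$ of $A'+t\alpha'$ is part of the integral curve of the following vector field in the variables $a_i,\alpha_i,Y_{ij}$: $$H_h=\sum_i\alpha_i\,\partial_{a_i}+2\sum_{a_j\ne a_i}\frac{Y_{ij}^2}{(a_i-a_j)^3}\,\partial_{\alpha_i}+\sum_{a_i\ne a_j,\,k}\frac{Y_{ij}Y_{jk}}{(a_i-a_j)^2}\,\partial_{Y_{ki}}-\sum_{i,\,a_j\ne a_k}\frac{Y_{ij}Y_{jk}}{(a_j-a_k)^2}\,\partial_{Y_{ki}},$$ with differential equations $$\ddot a_i=2\sum_{a_j\ne a_i}\frac{Y_{ij}^2}{(a_i-a_j)^3},\qquad \dot Y=[Y,Z],\qquad\text{where } Z_{ij}=-\frac{Y_{ij}}{(a_i-a_j)^2},$$ and where $Y_{ij}=Z_{ij}=0$ whenever $a_i=a_j$.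
   Context: The variables arise by symplectic reduction of $T^*S(n)=S(n)\times S(n)$ with Hamiltonian $h(A,\alpha)=\frac12\mathrm{Tr}(\alpha^2)$ and momentum mapping $J(A,\alpha)=[A,\alpha]$: a pair consisting of a point of the line and its direction is moved by a common conjugation with an element of $SO(n)$ to $(A,\alpha)$ with $A=\mathrm{diag}(a_1\ge a_2\ge\dots\ge a_n)$; then $\alpha_i:=\alpha_{ii}$ and $Y=[A,\alpha]$, so $Y_{ij}=\alpha_{ij}(a_i-a_j)$. $H_h$ is the Hamiltonian vector field of $h$ in these coordinates. $[\cdot,\cdot]$ is the matrix commutator, and dots denote $d/dt$.
   Formalization: The equations are asserted only at times near which the set of equalities a_i=a_j is constant (all but finitely many t), since ordered eigenvalues can have kinks at collisions; the last two sums of H_h are attached to the (i,k) entry of Y, as the printed ∂_{Y_ki} contradicts Ẏ=[Y,Z]. *)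

(* Defs.v *)
From HB Require Import structures.
From mathcomp Require Import all_boot all_order all_algebra.
From mathcomp Require Import all_classical all_reals all_analysis.

Set Implicit Arguments.
Unset Strict Implicit.
Unset Printing Implicit Defensive.

Import Order.TTheory GRing.Theory Num.Theory.
Import numFieldNormedType.Exports.

Local Open Scope classical_set_scope.
Local Open Scope ring_scope.

Definition special_orthogonal (R : realType) (n : nat) (g : 'M[R]_n) : Prop :=
  g *m g^T = 1%:M /\ \det g = 1.

(* For g in SO(n) this is g X g^-1. *)
Definition conjugate (R : realType) (n : nat) (g X : 'M[R]_n) : 'M[R]_n :=
  g *m X *m g^T.

Definition commutator_mx (R : realType) (n : nat) (X Y : 'M[R]_n) : 'M[R]_n :=
  X *m Y - Y *m X.

(* The eigenvalues, repeated according to multiplicity, in the order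
   a_1 >= a_2 >= ... >= a_n. *)
Definition ordered_eigenvalues (R : realType) (n : nat)
    (X : 'M[R]_n) (a : 'rV[R]_n) : Prop :=
  (forall i j : 'I_n, (i <= j)%N -> a 0 j <= a 0 i) /\
  char_poly X = \prod_(i < n) ('X - (a 0 i)%:P).

(* t is not a collision time: the equalities a_i = a_j holding at t are exactly
   those holding at all nearby times.  Multiple eigenvalues are allowed. *)
Definition collision_free (R : realType) (n : nat) (a : R -> 'rV[R]_n)
    (t : R) : Prop :=
  \forall s \near t, forall i j : 'I_n, a s 0 i = a s 0 j <-> a t 0 i = a t 0 j.

(* The variables ((a_i), (alpha_i), (Y_ij)). *)
Definition phase (R : realType) (n : nat) : normedModType R :=
  ('rV[R]_n * 'rV[R]_n * 'M[R]_n)%type.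

Definition d_a (R : realType) (n : nat) (i : 'I_n) : phase R n :=
  (delta_mx 0 i, 0, 0).
Definition d_alpha (R : realType) (n : nat) (i : 'I_n) : phase R n :=
  (0, delta_mx 0 i, 0).
Definition d_Y (R : realType) (n : nat) (i j : 'I_n) : phase R n :=
  (0, 0, delta_mx i j).

(* The coefficients of the last two sums are attached to the (i, k) entry of Y:
   for skew Y, their value is the (i, k) entry of [Y, Z], with Z as in Z_mx.
   Attached to the (k, i) entry, the field would give dY/dt = - [Y, Z]. *)
Definition H_h (R : realType) (n : nat) (x : phase R n) : phase R n :=
  let a := fun i : 'I_n => x.1.1 0 i in
  let alpha := fun i : 'I_n => x.1.2 0 i in
  let Y := fun i j : 'I_n => x.2 i j in
    \sum_(i < n) alpha i *: d_a R i
  + 2 *: (\sum_(i < n) \sum_(j < n | a j != a i)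
            (Y i j ^+ 2 / (a i - a j) ^+ 3) *: d_alpha R i)
  + \sum_(i < n) \sum_(j < n | a i != a j) \sum_(k < n)
       (Y i j * Y j k / (a i - a j) ^+ 2) *: d_Y R i k
  - \sum_(i < n) \sum_(j < n) \sum_(k < n | a j != a k)
       (Y i j * Y j k / (a j - a k) ^+ 2) *: d_Y R i k.

Definition Z_mx (R : realType) (n : nat) (a : 'rV[R]_n) (Y : 'M[R]_n) :
    'M[R]_n :=
  \matrix_(i < n, j < n)
    if a 0 i == a 0 j then 0 else - (Y i j / (a 0 i - a 0 j) ^+ 2).

Definition integral_curve_at (R : realType) (V : normedModType R)
    (F : V -> V) (c : R -> V) (t : R) : Prop :=
  is_derive t (1 : R) c (F (c t)).

(* Main.v *)
Require Import Defs.
From HB Require Import structures.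
From mathcomp Require Import all_boot all_order all_algebra.
From mathcomp Require Import all_classical all_reals all_analysis.
From mathcomp Require Import ring lra.

Import Order.TTheory GRing.Theory Num.Theory.
Import numFieldNormedType.Exports.

Local Open Scope classical_set_scope.
Local Open Scope ring_scope.

Set Implicit Arguments.
Unset Strict Implicit.
Unset Printing Implicit Defensive.

(** A frame at t is an orthogonal g(t) with g(t) (A' + t alpha') g(t)^T = diag a(t).
    For two frames, M = g(s) g(t)^T satisfies
      M_ij (a_i(s) - a_j(t)) = (s - t) (M alpha(t))_ij.
    Hence the eigenvalues are Lipschitz, and away from collisions the entries of M
    outside the eigenvalue blocks have derivative alpha_ij / (a_i - a_j) = - Z_ij
    at s = t.  The frame has to be chosen so that the entries inside the blocks
    are 1 + O((s - t)^2), that is, by parallel transport (Kato) of the eigenspaces.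
    Then M' = - Z at s = t, and since alpha(s) = M alpha(t) M^T and
    Y(s) = g(s) [A', alpha'] g(s)^T = M Y(t) M^T, all the equations follow.

    No ODE is solved to get the parallel frame.  On a grid of mesh 1/(N+1), each
    frame is chosen nearest to the previous one (maximal trace of h g^T), which
    makes the blocks of the transition symmetric and positive, hence 1 + O(1/N^2);
    these errors add up to O((s - t)^2) along the grid, and an ultrafilter limit as
    N tends to infinity gives the frame, through all collisions at once.

    The collision times are finitely many because the Hankel matrix of the power
    sums tr (A' + t alpha')^(p+q), p, q < m, has a determinant which is a polynomial
    in t and vanishes exactly when there are fewer than m distinct eigenvalues;
    take m the maximal number of distinct eigenvalues. *)

(** * Orthogonal diagonalization with a prescribed order *)

(* For w = 0 the junk value 2 / 0 = 0 makes this the identity. *)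
Definition reflection (R : realType) (n : nat) (w : 'rV[R]_n) : 'M[R]_n :=
  1%:M - (2 / (w *m w^T) 0 0) *: (w^T *m w).

Lemma row_norm_gt0 (R : realType) (n : nat) (w : 'rV[R]_n) :
  w != 0 -> 0 < (w *m w^T) 0 0.
Proof.
move=> w0; rewrite mxE.
have w2 i : 0 <= w 0 i * w^T i 0 by rewrite !mxE -expr2 sqr_ge0.
rewrite lt_neqAle eq_sym sumr_ge0 // andbT.
apply: contraNneq w0 => /eqP; rewrite psumr_eq0 // => /allP h.
apply/eqP/rowP => i; rewrite !mxE; apply/eqP.
by have := h i (mem_index_enum _); rewrite !mxE -expr2 sqrf_eq0.
Qed.

Lemma tr_reflection (R : realType) (n : nat) (w : 'rV[R]_n) :
  (reflection w)^T = reflection w.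
Proof.
by rewrite /reflection linearB /= linearZ /= trmx1 trmx_mul trmxK.
Qed.

Lemma reflectionK (R : realType) (n : nat) (w : 'rV[R]_n) :
  reflection w *m reflection w = 1%:M.
Proof.
rewrite /reflection; set s := (w *m w^T) 0 0; set c := 2 / s.
have QQ : w^T *m w *m (w^T *m w) = s *: (w^T *m w).
  by rewrite -mulmxA [w *m (_ *m _)]mulmxA [w *m w^T]mx11_scalar mul_scalar_mx -scalemxAr.
have cs : c * c * s = 2 * c.
  have [w0|w0] := eqVneq w 0.
    by rewrite /c /s w0 mul0mx mxE invr0 !mulr0.
  by rewrite /c; have := row_norm_gt0 w0; rewrite -/s => s0; field; rewrite gt_eqF.
rewrite mulmxBr mulmx1 mulmxBl mul1mx -scalemxAl -scalemxAr QQ !scalerA cs.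
by rewrite mulrDl mul1r scalerDl; move: (c *: _) => q; rewrite opprB addrK subrK.
Qed.

Lemma reflection_orthogonal (R : realType) (n : nat) (w : 'rV[R]_n) :
  reflection w *m (reflection w)^T = 1%:M.
Proof. by rewrite tr_reflection reflectionK. Qed.

(** For unit vectors, u (u - v)^T = 1 - u v^T is half of |u - v|^2, so the reflection along u - v
    subtracts exactly u - v from u. For u = v the reflection is the identity by its default
    value. *)
Lemma reflection_exchange (R : realType) (n : nat) (u v : 'rV[R]_n) :
  (u *m u^T) 0 0 = 1 -> (v *m v^T) 0 0 = 1 -> u *m reflection (u - v) = v.
Proof.
move=> u1 v1; have [->|uv] := eqVneq u v.
  by rewrite /reflection subrr mul0mx mxE invr0 mulr0 scale0r subr0 mulmx1.
have := row_norm_gt0 (n := n) (w := u - v); rewrite subr_eq0 => /(_ uv).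
rewrite /reflection.
have vu : (v *m u^T) 0 0 = (u *m v^T) 0 0.
  by rewrite -[v in LHS]trmxK -trmx_mul mxE.
have -> : ((u - v) *m (u - v)^T) 0 0 = 2 * (1 - (u *m v^T) 0 0).
  by rewrite linearB /= mulmxBr !mulmxBl !mxE in u1 v1 vu *; rewrite u1 v1 vu; ring.
move=> d0; rewrite mulmxBr mulmx1 -scalemxAr mulmxA.
rewrite [u *m (u - v)^T]mx11_scalar mul_scalar_mx scalerA.
have -> : (u *m (u - v)^T) 0 0 = 1 - (u *m v^T) 0 0.
  by rewrite linearB /= mulmxBr !mxE in u1 *; rewrite u1.
set d := 1 - _ in d0 *.
have -> : 2 / (2 * d) * d = 1 by field; lra.
by rewrite scale1r opprB addrC subrK.
Qed.

Lemma char_poly_conjugate (R : realType) (n : nat) (g X : 'M[R]_n) :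
  g *m g^T = 1%:M -> char_poly (g *m X *m g^T) = char_poly X.
Proof.
move=> gg; have Pgg : map_mx polyC g *m map_mx polyC g^T = 1%:M.
  by rewrite -map_mxM gg map_mx1.
rewrite /char_poly.
have -> : char_poly_mx (g *m X *m g^T) =
    map_mx polyC g *m char_poly_mx X *m map_mx polyC g^T.
  rewrite /char_poly_mx !map_mxM mulmxBr mulmxBl scalar_mxC -(mulmxA _%:M).
  by rewrite Pgg mulmx1.
by rewrite !det_mulmx mulrAC -det_mulmx Pgg det1 mul1r.
Qed.

(** Deflation by induction on n: a reflection moves a unit eigenvector for [a 0 0] to the first
    basis vector, symmetry splits off a 1 x 1 block, and the remaining block is diagonalized with
    the remaining entries of [a], in the given order. *)
Lemma symmetric_diagonalization (R : realType) (n : nat) (X : 'M[R]_n)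
    (a : 'rV[R]_n) :
  X^T = X -> char_poly X = \prod_(i < n) ('X - (a 0 i)%:P) ->
  exists2 g : 'M[R]_n, g *m g^T = 1%:M & g *m X *m g^T = diag_mx a.
Proof.
elim: n X a => [|n IH] X a Xs Xa.
  by exists 1%:M; [rewrite trmx1 mulmx1 | apply/matrixP => -[]].
have : eigenvalue X (a 0 0).
  rewrite eigenvalue_root_char Xa big_ord_recl rootM root_XsubC eqxx //.
case/eigenvalueP => v vX v0.
have s0 := row_norm_gt0 v0; set s := (v *m v^T) 0 0 in s0.
pose u := (Num.sqrt s)^-1 *: v.
have u1 : (u *m u^T) 0 0 = 1.
  rewrite /u linearZ /= -scalemxAl -scalemxAr scalerA mxE -/s -invfM -expr2.
  by rewrite sqr_sqrtr ?ltW // mulVf // gt_eqF.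
have uX : u *m X = a 0 0 *: u.
  by rewrite /u -scalemxAl vX !scalerA mulrC.
pose e : 'rV[R]_n.+1 := delta_mx 0 0.
have e1 : (e *m e^T) 0 0 = 1.
  by rewrite /e trmx_delta mul_delta_mx mxE !eqxx.
pose h := reflection (e - u).
have hh : h *m h^T = 1%:M by exact: reflection_orthogonal.
have eh : e *m h = u by exact: reflection_exchange.
have uh : u *m h^T = e by rewrite -eh -mulmxA hh mulmx1.
have [B BE] : {B : 'M[R]_(1 + n) | B = h *m X *m h^T} by exists (h *m X *m h^T).
have BT : B^T = B by rewrite BE !trmx_mul trmxK Xs mulmxA.
have eB : e *m B = a 0 0 *: e.
  by rewrite BE !mulmxA eh uX -scalemxAl uh.
have B0 (i j : 'I_(1 + n)) : i = 0%N :> nat ->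
    B i j = a 0 0 * (j == 0%N :> nat)%:R.
  move=> i0; have -> : i = 0 by apply/val_inj.
  by have /rowP/(_ j) := eB; rewrite -rowE !mxE => ->.
have eB4 : B = block_mx (a 0 0)%:M 0 0 (drsubmx B).
  rewrite -[LHS]submxK; congr block_mx; apply/matrixP => i j.
  - by rewrite !ord1 !mxE /= B0 // mulr1.
  - by rewrite !ord1 !mxE /= B0 // mulr0.
  - by rewrite !ord1 !mxE /= -BT mxE B0 // mulr0.
set X' := drsubmx B in eB4.
have X's : X'^T = X' by rewrite /X' trmx_drsub BT.
pose a' : 'rV[R]_n := \row_i a 0 (lift 0 i).
have X'a : char_poly X' = \prod_(i < n) ('X - (a' 0 i)%:P).
  have : @char_poly R (1 + n) B = char_poly X.
    by rewrite BE; exact: char_poly_conjugate.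
  (* The corner block contributes the factor ['X - (a 0 0)%:P], which cancels against the first
     factor of the product for X. *)
  rewrite Xa eB4 {1}/char_poly char_block_diag_mx det_ublock big_ord_recl.
  have -> : \det (char_poly_mx ((a 0 0)%:M : 'M[R]_1)) = 'X - (a 0 0)%:P.
    by rewrite det_mx11 !mxE eqxx !mulr1n.
  rewrite -/(char_poly X') => /mulfI ->; first by apply: eq_bigr => i _; rewrite mxE.
  by rewrite polyXsubC_eq0.
have [g' gg' gX'] := IH _ _ X's X'a.
pose k : 'M[R]_(1 + n) := block_mx 1%:M 0 0 g'.
have kT : k^T = block_mx 1%:M 0 0 g'^T.
  by rewrite /k tr_block_mx !trmx0 trmx1.
have kk : k *m k^T = 1%:M.
  rewrite kT mulmx_block !(mulmx0, mul0mx, mulmx1, addr0, add0r) gg'.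
  by rewrite -scalar_mx_block.
exists (k *m h).
  by rewrite trmx_mul mulmxA -(mulmxA k h) hh mulmx1.
have -> : k *m h *m X *m (k *m h)^T = k *m B *m k^T.
  by rewrite trmx_mul BE !mulmxA.
rewrite kT eB4 !mulmx_block !(mulmx0, mul0mx, mulmx1, mul1mx, addr0, add0r) gX'.
apply/(@matrixP _ (1 + n) (1 + n)) => i j; rewrite [RHS]mxE.
case: (split_ordP i) => i' ->; case: (split_ordP j) => j' ->.
- by rewrite block_mxEul !ord1 !mxE !eqxx; congr (a 0 _ *+ _); apply/val_inj.
- by rewrite block_mxEur mxE !ord1; case: eqP.
- by rewrite block_mxEdl mxE !ord1; case: eqP.
rewrite block_mxEdr !mxE; congr (a 0 _ *+ nat_of_bool _); first exact/val_inj.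
Qed.

(** * Transitions between frames and Weyl's inequality *)

Definition frame (R : realType) (n : nat) (L : 'M[R]_n) (d : 'rV[R]_n)
    (g : 'M[R]_n) : Prop :=
  g *m g^T = 1%:M /\ g *m L *m g^T = diag_mx d.

Definition entry_norm (R : realType) (m n : nat) (X : 'M[R]_(m, n)) : R :=
  \sum_i \sum_j `|X i j|.

Lemma entry_norm_ge0 (R : realType) (m n : nat) (X : 'M[R]_(m, n)) :
  0 <= entry_norm X.
Proof. by apply: sumr_ge0 => i _; apply: sumr_ge0. Qed.

Lemma entry_normZ (R : realType) (m n : nat) (c : R) (X : 'M[R]_(m, n)) :
  entry_norm (c *: X) = `|c| * entry_norm X.
Proof.
rewrite mulr_sumr; apply: eq_bigr => i _; rewrite mulr_sumr.
by apply: eq_bigr => j _; rewrite mxE normrM.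
Qed.

Lemma orthogonal_mulT (R : realType) (n : nat) (h g : 'M[R]_n) :
  h *m h^T = 1%:M -> g *m g^T = 1%:M -> (h *m g^T) *m (h *m g^T)^T = 1%:M.
Proof.
move=> hh gg; rewrite trmx_mul trmxK mulmxA -(mulmxA h).
by rewrite (mulmx1C gg) mulmx1.
Qed.

Lemma orthogonal_row_norm (R : realType) (n : nat) (g : 'M[R]_n) (i : 'I_n) :
  g *m g^T = 1%:M -> \sum_j g i j ^+ 2 = 1.
Proof.
move=> /matrixP/(_ i i); rewrite !mxE eqxx mulr1n => <-.
by apply: eq_bigr => j _; rewrite mxE expr2.
Qed.

Lemma orthogonal_col_norm (R : realType) (n : nat) (g : 'M[R]_n) (j : 'I_n) :
  g *m g^T = 1%:M -> \sum_i g i j ^+ 2 = 1.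
Proof.
move=> /mulmx1C gg; rewrite -(@orthogonal_row_norm _ _ g^T j) ?trmxK //.
by apply: eq_bigr => i _; rewrite mxE.
Qed.

Lemma orthogonal_entry_le1 (R : realType) (n : nat) (g : 'M[R]_n)
    (i j : 'I_n) :
  g *m g^T = 1%:M -> `|g i j| <= 1.
Proof.
move=> /(orthogonal_row_norm i) g1; rewrite -(@ler_pXn2r _ 2) ?nnegrE //.
rewrite expr1n real_normK ?num_real // -g1 (bigD1 j) //= lerDl.
by apply: sumr_ge0 => k _; rewrite sqr_ge0.
Qed.

Lemma orthogonal_mul_entry_le (R : realType) (n : nat) (h X g : 'M[R]_n)
    (i j : 'I_n) :
  h *m h^T = 1%:M -> g *m g^T = 1%:M ->
  `|(h *m X *m g^T) i j| <= entry_norm X.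
Proof.
move=> hh gg; rewrite mxE /entry_norm exchange_big /=.
apply: (le_trans (ler_norm_sum _ _ _)); apply: ler_sum => l _.
rewrite normrM [g^T _ _]mxE -[leRHS]mulr1.
apply: ler_pM => //; last exact: orthogonal_entry_le1.
rewrite mxE; apply: (le_trans (ler_norm_sum _ _ _)); apply: ler_sum => k _.
by rewrite normrM -[leRHS]mul1r ler_wpM2r // orthogonal_entry_le1.
Qed.

(** Since h L2 = diag d2 h and L1 g^T = g^T diag d1, the matrix h (L2 - L1) g^T equals diag d2 M - M
    diag d1 with M = h g^T. *)
Lemma frame_transition (R : realType) (n : nat) (L1 L2 : 'M[R]_n)
    (d1 d2 : 'rV[R]_n) (g h : 'M[R]_n) (i j : 'I_n) :
  frame L1 d1 g -> frame L2 d2 h ->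
  (h *m g^T) i j * (d2 0 i - d1 0 j) = (h *m (L2 - L1) *m g^T) i j.
Proof.
move=> [gg gL] [hh hL].
have -> : h *m (L2 - L1) *m g^T = diag_mx d2 *m (h *m g^T) - h *m g^T *m diag_mx d1.
  rewrite -gL -hL !mulmxA mulmxBr mulmxBl; congr (_ - _).
    by rewrite -[_ *m h^T *m h]mulmxA (mulmx1C hh) mulmx1.
  by rewrite -[_ *m g^T *m g]mulmxA (mulmx1C gg) mulmx1.
rewrite mul_diag_mx mul_mx_diag; move: (h *m g^T) => M.
by rewrite !mxE; ring.
Qed.

(* The upper right block of rows k <= i and columns j >= i of an orthogonal
   matrix has squared norm at least (i + 1) - i, which plays the role of the
   dimension count in Weyl's inequality. *)
Lemma orthogonal_corner_norm (R : realType) (n : nat) (M : 'M[R]_n)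
    (i : 'I_n) :
  M *m M^T = 1%:M ->
  1 <= \sum_(k < n | (k <= i)%N) \sum_(j < n | (i <= j)%N) M k j ^+ 2.
Proof.
move=> MM.
have rows : \sum_(k < n | (k <= i)%N) \sum_j M k j ^+ 2 =
    1 + \sum_(k < n | (k < i)%N) (1 : R).
  rewrite (bigD1 i) //= orthogonal_row_norm //; congr (_ + _).
  apply: eq_big => [k|k _]; last by rewrite orthogonal_row_norm.
  by rewrite ltn_neqAle andbC.
have cols : \sum_(k < n | (k <= i)%N) \sum_(j < n | (j < i)%N) M k j ^+ 2 <=
    \sum_(j < n | (j < i)%N) (1 : R).
  rewrite exchange_big /=; apply: ler_sum => j _.
  rewrite -(orthogonal_col_norm j MM) [leRHS](bigID (fun k : 'I_n => (k <= i)%N)) /=.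
  by rewrite lerDl; apply: sumr_ge0 => k _; rewrite sqr_ge0.
have split_rows : \sum_(k < n | (k <= i)%N) \sum_j M k j ^+ 2 =
    \sum_(k < n | (k <= i)%N) \sum_(j < n | (i <= j)%N) M k j ^+ 2 +
    \sum_(k < n | (k <= i)%N) \sum_(j < n | (j < i)%N) M k j ^+ 2.
  rewrite -big_split /=; apply: eq_bigr => k _.
  rewrite (bigID (fun j : 'I_n => (i <= j)%N)) /=; congr (_ + _).
  by apply: eq_bigl => j; rewrite ltnNge.
by move: rows; rewrite split_rows; lra.
Qed.

(** Let x = d2_i - d1_i > 0. By the ordering, d2_k - d1_j >= x whenever k <= i <= j, so
    [frame_transition] bounds x |M_kj| by E on that corner. The squares of the corner entries sum to
    at least 1, hence x^2 <= n^2 E^2. *)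
Lemma weyl_le (R : realType) (n : nat) (L1 L2 : 'M[R]_n)
    (d1 d2 : 'rV[R]_n) (g h : 'M[R]_n) (i : 'I_n) :
  (forall i j : 'I_n, (i <= j)%N -> d1 0 j <= d1 0 i) ->
  (forall i j : 'I_n, (i <= j)%N -> d2 0 j <= d2 0 i) ->
  frame L1 d1 g -> frame L2 d2 h ->
  d2 0 i - d1 0 i <= n%:R * entry_norm (L2 - L1).
Proof.
move=> o1 o2 fg fh; set x := _ - _; set E := entry_norm _.
have E0 : 0 <= E := entry_norm_ge0 _.
have [x0|x0] := leP x 0.
  by apply: (le_trans x0); rewrite mulr_ge0.
have MM := orthogonal_mulT fh.1 fg.1; set M := h *m g^T in MM.
have Mx (k j : 'I_n) : (k <= i)%N -> (i <= j)%N -> M k j ^+ 2 * x ^+ 2 <= E ^+ 2.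
  move=> ki ij; rewrite -exprMn -[leLHS]real_normK ?num_real //.
  rewrite ler_pXn2r ?nnegrE // normrM (gtr0_norm x0).
  have xkj : x <= d2 0 k - d1 0 j by have := o2 _ _ ki; have := o1 _ _ ij; rewrite /x; lra.
  have := orthogonal_mul_entry_le (L2 - L1) k j fh.1 fg.1.
  rewrite -(frame_transition k j fg fh) -/E -/M normrM => /(le_trans _); apply.
  by apply: ler_wpM2l => //; rewrite (le_trans xkj) // ler_norm.
have := orthogonal_corner_norm i MM => c1.
rewrite -(@ler_pXn2r _ 2) ?nnegrE ?mulr_ge0 ?(ltW x0) //.
apply: (@le_trans _ _ (\sum_(k < n) \sum_(j < n) E ^+ 2)); last first.
  by rewrite !sumr_const card_ord -mulrnA exprMn -natrX mulr_natl mulnn.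
rewrite -[leLHS]mul1r; apply: (le_trans (ler_wpM2r (sqr_ge0 _) c1)).
rewrite mulr_suml [leRHS](bigID (fun k : 'I_n => (k <= i)%N)) /= -[leLHS]addr0.
apply: lerD; last by apply: sumr_ge0 => k _; apply: sumr_ge0 => j _; rewrite sqr_ge0.
apply: ler_sum => k ki.
rewrite mulr_suml [leRHS](bigID (fun j : 'I_n => (i <= j)%N)) /= -[leLHS]addr0.
apply: lerD; last by apply: sumr_ge0 => j _; rewrite sqr_ge0.
by apply: ler_sum => j ij; exact: Mx.
Qed.

Lemma weyl (R : realType) (n : nat) (L1 L2 : 'M[R]_n)
    (d1 d2 : 'rV[R]_n) (g h : 'M[R]_n) (i : 'I_n) :
  (forall i j : 'I_n, (i <= j)%N -> d1 0 j <= d1 0 i) ->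
  (forall i j : 'I_n, (i <= j)%N -> d2 0 j <= d2 0 i) ->
  frame L1 d1 g -> frame L2 d2 h ->
  `|d2 0 i - d1 0 i| <= n%:R * entry_norm (L2 - L1).
Proof.
move=> o1 o2 fg fh; rewrite ler_norml (weyl_le i o1 o2 fg fh) andbT.
have := weyl_le i o2 o1 fh fg.
have -> : entry_norm (L1 - L2) = entry_norm (L2 - L1).
  by apply: eq_bigr => k _; apply: eq_bigr => j _; rewrite !mxE distrC.
by move: (n%:R * _) => c; lra.
Qed.

(** * Nearest frames *)

Definition nearest_frame (R : realType) (n : nat) (L : 'M[R]_n) (d : 'rV[R]_n)
    (g h : 'M[R]_n) : Prop :=
  frame L d h /\ forall h', frame L d h' -> \tr (h' *m g^T) <= \tr (h *m g^T).

(** A reflection along an eigenvector of diag d commutes with diag d. These reflections are the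
    variations used against the maximality of the trace. *)
Lemma reflection_frame (R : realType) (n : nat) (L : 'M[R]_n) (d : 'rV[R]_n)
    (h : 'M[R]_n) (w : 'rV[R]_n) (c : R) :
  w *m diag_mx d = c *: w -> frame L d h -> frame L d (reflection w *m h).
Proof.
move=> wd [hh hL]; split.
  rewrite trmx_mul mulmxA -(mulmxA (reflection w)) hh mulmx1.
  exact: reflection_orthogonal.
have -> : reflection w *m h *m L *m (reflection w *m h)^T =
    reflection w *m diag_mx d *m reflection w.
  by rewrite -hL trmx_mul tr_reflection !mulmxA.
have -> : reflection w *m diag_mx d = diag_mx d *m reflection w.
  rewrite /reflection mulmxBl mulmxBr mul1mx mulmx1 -scalemxAl -scalemxAr.
  rewrite -mulmxA wd mulmxA.
  have -> : diag_mx d *m w^T = c *: w^T.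
    by rewrite -[diag_mx d]tr_diag_mx -trmx_mul wd linearZ.
  by rewrite -scalemxAl -scalemxAr.
by rewrite -mulmxA reflectionK mulmx1.
Qed.

Lemma mxtrace_reflection_mul (R : realType) (n : nat) (w : 'rV[R]_n)
    (M : 'M[R]_n) :
  \tr (reflection w *m M) = \tr M - 2 / (w *m w^T) 0 0 * (w *m M *m w^T) 0 0.
Proof.
rewrite /reflection mulmxBl mul1mx -scalemxAl linearB /= linearZ /=.
by rewrite -[w^T *m w *m M]mulmxA mxtrace_mulC trace_mx11.
Qed.

(** Reflecting h along w lowers the trace by a positive multiple of w M w^T, where M = h g^T, so
    maximality forces this number to be nonnegative. *)
Lemma nearest_frame_psd (R : realType) (n : nat) (L : 'M[R]_n) (d : 'rV[R]_n)
    (g h : 'M[R]_n) (w : 'rV[R]_n) (c : R) :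
  nearest_frame L d g h -> w *m diag_mx d = c *: w ->
  0 <= (w *m (h *m g^T) *m w^T) 0 0.
Proof.
move=> [fh hmax] wd; have [->|/row_norm_gt0 w0] := eqVneq w 0.
  by rewrite !mul0mx mxE.
have := hmax _ (reflection_frame wd fh).
rewrite -mulmxA mxtrace_reflection_mul.
have : 0 < 2 / (w *m w^T) 0 0 by rewrite divr_gt0.
move: (2 / _) => s s0; rewrite gerBl => h0.
by move: h0; rewrite pmulr_rge0.
Qed.

(** The first-order condition at a maximum, in algebraic form: a linear term dominated by a
    quadratic one vanishes. The test value y = x / (|p| + 1) already gives x^2 <= 0. *)
Lemma eq_zero_of_le_sqr (R : realType) (x p : R) :
  (forall y, y * x <= y ^+ 2 * p) -> x = 0.
Proof.
move=> /(_ (x / (`|p| + 1))) xp; have p0 : 0 < `|p| + 1.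
  by rewrite ltr_wpDl.
have pp : p <= `|p| by exact: ler_norm.
have := ler_wpM2r (sqr_ge0 (`|p| + 1)) xp.
have -> : x / (`|p| + 1) * x * (`|p| + 1) ^+ 2 = x ^+ 2 * (`|p| + 1).
  by field; rewrite gt_eqF.
have -> : (x / (`|p| + 1)) ^+ 2 * p * (`|p| + 1) ^+ 2 = x ^+ 2 * p.
  by field; rewrite gt_eqF.
move=> h; apply/eqP; rewrite -sqrf_eq0; apply/eqP.
by have := sqr_ge0 x; move: (x ^+ 2) h => z; nra.
Qed.

Lemma nearest_frame_sym (R : realType) (n : nat) (L : 'M[R]_n) (d : 'rV[R]_n)
    (g h : 'M[R]_n) (i j : 'I_n) :
  nearest_frame L d g h -> d 0 i = d 0 j -> (h *m g^T) i j = (h *m g^T) j i.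
Proof.
move=> [fh hmax] dij; have [->//|ij] := eqVneq i j.
have ed k : delta_mx 0 k *m diag_mx d = d 0 k *: delta_mx 0 k :> 'rV[R]_n.
  by rewrite -rowE row_diag_mx.
pose v : 'rV[R]_n := delta_mx 0 i.
(* Two successive reflections rotate the plane of i and j by an angle of
   tangent half y; the trace is maximal at y = 0. *)
pose w (y : R) : 'rV[R]_n := delta_mx 0 i + y *: delta_mx 0 j.
have wd y : w y *m diag_mx d = d 0 i *: w y.
  by rewrite mulmxDl -scalemxAl !ed -dij scalerDr scalerA mulrC -scalerA.
set M := h *m g^T.
have eD (X Y : 'M[R]_1) : (X + Y) 0 0 = X 0 0 + Y 0 0 by rewrite mxE.
have eN (X : 'M[R]_1) : (- X) 0 0 = - X 0 0 by rewrite mxE.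
have eZ (c : R) (X : 'M[R]_1) : (c *: X) 0 0 = c * X 0 0 by rewrite mxE.
have vv : (v *m v^T) 0 0 = 1 by rewrite /v trmx_delta mul_delta_mx mxE !eqxx.
have bil a b : ((delta_mx 0 a : 'rV[R]_n) *m M *m (delta_mx 0 b : 'rV[R]_n)^T) 0 0 = M a b.
  by rewrite trmx_delta -rowE -colE !mxE.
have bil1 a b : ((delta_mx 0 a : 'rV[R]_n) *m (delta_mx 0 b : 'rV[R]_n)^T) 0 0 = (a == b)%:R :> R.
  by rewrite trmx_delta mul_delta_mx_cond; case: (a == b); rewrite ?mulr1n ?mulr0n !mxE ?eqxx.
suff : M i j - M j i = 0 by lra.
apply: (@eq_zero_of_le_sqr _ _ (M i i + M j j)) => y.
have := hmax _ (reflection_frame (wd y) (reflection_frame (ed i) fh)).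
rewrite -!mulmxA -/M !mxtrace_reflection_mul -/v vv.
have ww : (w y *m (w y)^T) 0 0 = 1 + y ^+ 2.
  rewrite /w linearD /= linearZ /= mulmxDl !mulmxDr -!scalemxAl -!scalemxAr.
  by rewrite !(eD, eZ) !bil1 !eqxx [j == i]eq_sym (negbTE ij) mulr1n mulr0n; ring.
have vw : (v *m (w y)^T) 0 0 = 1.
  by rewrite /w linearD /= linearZ /= mulmxDr -scalemxAr !(eD, eZ) !bil1 eqxx (negbTE ij) mulr1n mulr0n; ring.
have wv : (w y *m v^T) 0 0 = 1.
  have <- : (v *m (w y)^T)^T = w y *m v^T by rewrite trmx_mul trmxK.
  by rewrite [LHS]mxE.
have -> : (w y *m (reflection v *m M) *m (w y)^T) 0 0 =
    (w y *m M *m (w y)^T) 0 0 - 2 * (v *m M *m (w y)^T) 0 0.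
  rewrite /reflection vv mulmxBl mul1mx -scalemxAl mulmxBr mulmxBl.
  rewrite -scalemxAr -scalemxAl divr1 !mulmxA [w y *m v^T]mx11_scalar wv mul1mx.
  by rewrite eD eN eZ.
rewrite {}ww /v bil.
have -> : (w y *m M *m (w y)^T) 0 0 = M i i + y * (M i j + M j i) + y ^+ 2 * M j j.
  rewrite /w linearD /= linearZ /= !mulmxDl !mulmxDr -!scalemxAl -!scalemxAr.
  by rewrite !(eD, eZ) !bil; ring.
have -> : ((delta_mx 0 i : 'rV[R]_n) *m M *m (w y)^T) 0 0 = M i i + y * M i j.
  rewrite /w linearD /= linearZ /= !mulmxDr -!scalemxAr.
  by rewrite !(eD, eZ) !bil.
move: (\tr _) (M i i) (M j j) (M i j) (M j i) => t a b p q.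
have y1 : 0 < 1 + y ^+ 2 by rewrite ltr_wpDr // sqr_ge0.
(* After multiplication by 1 + y^2, maximality reads y (M_ij - M_ji) <= y^2 (M_ii + M_jj). *)
move=> /(ler_wpM2r (ltW y1)).
have -> : (t - 2 / 1 * a - 2 / (1 + y ^+ 2) *
    (a + y * (p + q) + y ^+ 2 * b - 2 * (a + y * p))) * (1 + y ^+ 2) =
    t * (1 + y ^+ 2) + 2 * (y * (p - q) - y ^+ 2 * (a + b)).
  by field; rewrite gt_eqF.
lra.
Qed.

Lemma mxtrace_mul_tr (R : realType) (n : nat) (X : 'M[R]_n) :
  \tr (X *m X^T) = \sum_i \sum_j X i j ^+ 2.
Proof.
rewrite /mxtrace; apply: eq_bigr => i _; rewrite mxE.
by apply: eq_bigr => j _; rewrite mxE expr2.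
Qed.

Lemma mxtrace_conj_rows (R : realType) (n : nat) (T S : 'M[R]_n) :
  \tr (T *m S *m T^T) = \sum_i (row i T *m S *m (row i T)^T) 0 0.
Proof.
rewrite /mxtrace; apply: eq_bigr => i _.
rewrite -row_mul mxE [RHS]mxE.
by apply: eq_bigr => j _; rewrite !mxE.
Qed.

(* With S the part of M = h g^T inside the eigenvalue blocks and T = 1 - S,
   one has T + T S = 1 - S^2, which only involves the entries of M outside the
   blocks, and |T| <= |T + T S| since S is positive. *)
Lemma nearest_frame_block_error (R : realType) (n : nat) (L : 'M[R]_n)
    (d : 'rV[R]_n) (g h : 'M[R]_n) (x : R) (i j : 'I_n) :
  g *m g^T = 1%:M -> nearest_frame L d g h ->
  (forall k l, d 0 k != d 0 l -> `|(h *m g^T) k l| <= x) ->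
  d 0 i = d 0 j -> `|(h *m g^T - 1%:M) i j| <= n%:R ^+ 2 * x ^+ 2.
Proof.
move=> gg nh Mx dij; have [fh _] := nh.
have MM := orthogonal_mulT fh.1 gg.
have msym := nearest_frame_sym nh.
have mpsd := nearest_frame_psd nh.
move: (h *m g^T) => M in Mx MM msym mpsd *.
pose S : 'M[R]_n := \matrix_(k, l) if d 0 k == d 0 l then M k l else 0.
have SE k l : S k l = if d 0 k == d 0 l then M k l else 0 by rewrite mxE.
have [T TE] : {T : 'M[R]_n | T = 1%:M - S} by exists (1%:M - S).
have [F FE] : {F : 'M[R]_n | F = T + T *m S} by exists (T + T *m S).
have ST : S^T = S.
  by apply/matrixP => k l; rewrite !mxE eq_sym; case: eqP => // e; exact: msym.
have Tout k l : d 0 k != d 0 l -> T k l = 0.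
  move=> kl; rewrite TE !mxE (negbTE kl) subr0.
  by have [e|//] := eqVneq k l; rewrite e eqxx in kl.
have rowT k : row k T *m diag_mx d = d 0 k *: row k T.
  apply/rowP => l; rewrite mul_mx_diag !mxE; have [<-|kl] := eqVneq (d 0 k) (d 0 l).
    by rewrite mulrC.
  by rewrite Tout // mul0r mulr0.
(* A row of T is supported in one eigenvalue block, so it is an eigenvector of diag d, and M and S
   define the same quadratic form on it. *)
have TSge0 k : 0 <= (row k T *m S *m (row k T)^T) 0 0.
  have -> : row k T *m S = \row_l if d 0 k == d 0 l then (row k T *m M) 0 l else 0.
    apply/rowP => l; rewrite !mxE; have [kl|kl] := eqVneq (d 0 k) (d 0 l).
      apply: eq_bigr => m _; rewrite SE -kl !mxE.
      by case: eqVneq => // km; rewrite Tout 1?eq_sym // !mul0r.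
    apply: big1 => m _; rewrite SE !mxE; case: eqVneq => ml; last by rewrite mulr0.
    by rewrite Tout ?mul0r // ml.
  have := mpsd _ _ (rowT k); rewrite !mxE => /le_trans; apply.
  apply: ler_sum => l _; rewrite [(\row__ _) _ _]mxE; case: eqVneq => // kl.
  by rewrite [(row k T)^T _ _]mxE [row k T _ _]mxE Tout // mulr0 mul0r.
(* Here F = 1 - S S^T = M M^T - S S^T. Inside a block, each entry is a sum of at most n products of
   two entries of M outside the blocks; outside the blocks it is zero. *)
have Fx k l : `|F k l| <= n%:R * x ^+ 2.
  have -> : F = 1%:M - S *m S^T.
    by rewrite FE ST TE mulmxBl mul1mx addrA subrK.
  have x0 : 0 <= n%:R * x ^+ 2 by rewrite mulr_ge0 // sqr_ge0.
  have [kl|kl] := eqVneq (d 0 k) (d 0 l); last first.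
    rewrite 2!mxE; have [e|_] := eqVneq k l; first by rewrite e eqxx in kl.
    rewrite mulr0n add0r mxE normrN mxE big1 ?normr0 // => m _.
    rewrite [S^T _ _]mxE !SE; have [km|km] := eqVneq (d 0 k) (d 0 m); last by rewrite mul0r.
    by rewrite -km eq_sym (negbTE kl) mulr0.
  rewrite -MM.
  have -> : (M *m M^T - S *m S^T) k l = \sum_m (M k m * M l m - S k m * S l m).
    by rewrite sumrB !mxE; congr (_ - _); apply: eq_bigr => m _; rewrite !mxE.
  apply: (le_trans (ler_norm_sum _ _ _)).
  apply: (@le_trans _ _ (\sum_(m < n) x ^+ 2)); last first.
    by rewrite sumr_const card_ord mulr_natl.
  apply: ler_sum => m _; rewrite !SE -kl.
  have [km|km] := eqVneq (d 0 k) (d 0 m); first by rewrite subrr normr0 sqr_ge0.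
  rewrite mul0r subr0 normrM expr2; apply: ler_pM => //; apply: Mx => //.
  by rewrite -kl.
(* In Frobenius norm, |T + T S|^2 = |T|^2 + 2 tr (T S T^T) + |T S|^2, and the last two terms are
   nonnegative. *)
have TF : \sum_k \sum_l T k l ^+ 2 <= \sum_k \sum_l F k l ^+ 2.
  rewrite -!mxtrace_mul_tr FE linearD /= mulmxDl !mulmxDr !linearD /=.
  rewrite -[leLHS]addr0 -addrA lerD2l.
  have TST : 0 <= \tr (T *m S *m T^T) by rewrite mxtrace_conj_rows; exact: sumr_ge0.
  rewrite trmx_mul ST mulmxA addr_ge0 // addr_ge0 //.
  have -> : T *m S *m (S *m T^T) = (T *m S) *m (T *m S)^T by rewrite trmx_mul ST.
  by rewrite mxtrace_mul_tr; apply: sumr_ge0 => k _; apply: sumr_ge0 => l _; rewrite sqr_ge0.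
have -> : (M - 1%:M) i j = - T i j by rewrite TE !mxE dij eqxx opprB.
have x0 : 0 <= n%:R * x ^+ 2 by rewrite mulr_ge0 // sqr_ge0.
have nx0 : 0 <= n%:R ^+ 2 * x ^+ 2 by rewrite mulr_ge0 // sqr_ge0.
rewrite normrN -(@ler_pXn2r _ 2) ?nnegrE //.
rewrite real_normK ?num_real //.
apply: (@le_trans _ _ (\sum_k \sum_l F k l ^+ 2)).
  apply: le_trans TF; rewrite (bigD1 i) //= (bigD1 j) //= -addrA lerDl.
  by rewrite addr_ge0 //; apply: sumr_ge0 => k _; rewrite ?sqr_ge0 //;
     apply: sumr_ge0 => l _; rewrite sqr_ge0.
apply: (@le_trans _ _ (\sum_(k < n) \sum_(l < n) (n%:R * x ^+ 2) ^+ 2)).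
  apply: ler_sum => k _; apply: ler_sum => l _.
  by rewrite -[leLHS]real_normK ?num_real // ler_pXn2r.
rewrite !sumr_const card_ord -mulrnA -[leLHS]mulr_natl natrM.
have -> : n%:R * n%:R * (n%:R * x ^+ 2) ^+ 2 = (n%:R ^+ 2 * x ^+ 2) ^+ 2 by ring.
exact: lexx.
Qed.

(** * Ultrafilter limits and existence of nearest frames *)

(** Compactness of [-b, b] gives a cluster point, and an ultrafilter converges to each of its
    cluster points. *)
Lemma ultra_bounded_cvg (R : realType) (T : Type) (U : set_system T)
    (u : T -> R) (b : R) :
  UltraFilter U -> (forall k, `|u k| <= b) -> exists l : R, u @ U --> l.
Proof.
move=> UU ub.
have [|p [_ clp]] := @segment_compact R (- b) b (u @ U) _.
  by rewrite nbhs_filterE; apply: (@filterE _ U) => k /=; rewrite in_itv /= -ler_norml; exact: ub.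
exists p => A pA; have [//|UnA] := in_ultra_setVsetC (u @^-1` A) UU.
by have [x [/= nAx Ax]] := clp (~` A) A UnA pA.
Qed.

Definition mx_cvg (R : realType) (T : Type) (F : set_system T) (m n : nat)
    (G : T -> 'M[R]_(m, n)) (g : 'M[R]_(m, n)) : Prop :=
  forall i j, (fun x => G x i j) @ F --> g i j.

Lemma ultra_bounded_mx_cvg (R : realType) (T : Type) (U : set_system T)
    (m n : nat) (G : T -> 'M[R]_(m, n)) (b : R) :
  UltraFilter U -> (forall k i j, `|G k i j| <= b) ->
  exists g : 'M[R]_(m, n), mx_cvg U G g.
Proof.
move=> UU Gb.
have Gl (ij : 'I_m * 'I_n) : {l : R | (fun k => G k ij.1 ij.2) @ U --> l}.
  by apply: cid; apply: (ultra_bounded_cvg (b := b) UU) => k.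
exists (\matrix_(i, j) sval (Gl (i, j))) => i j.
by rewrite mxE; exact: (svalP (Gl (i, j))).
Qed.

Section MxCvg.
Context (R : realType) (T : Type) (F : set_system T) {FF : ProperFilter F}.

Lemma mx_cvg_cst (m n : nat) (g : 'M[R]_(m, n)) : mx_cvg F (fun=> g) g.
Proof. by move=> i j; exact: cvg_cst. Qed.

Lemma cvg_finsum (I : finType) (f : I -> T -> R) (l : I -> R) :
  (forall i, f i x @[x --> F] --> l i) ->
  (\sum_i f i x) @[x --> F] --> \sum_i l i.
Proof.
move=> fl.
exact: (@cvg_big _ _ +%R 0 xpredT (@add_continuous R) _ _ _ f l).
Qed.

Lemma cvg_finprod (I : finType) (f : I -> T -> R) (l : I -> R) :
  (forall i, f i x @[x --> F] --> l i) ->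
  (\prod_i f i x) @[x --> F] --> \prod_i l i.
Proof.
move=> fl; elim: (index_enum I) => [|i r IH].
  by under eq_fun do rewrite big_nil; rewrite big_nil; exact: cvg_cst.
by under eq_fun do rewrite big_cons; rewrite big_cons; exact: cvgM.
Qed.

Lemma mx_cvg_mul (m n p : nat) (G : T -> 'M[R]_(m, n)) (H : T -> 'M[R]_(n, p)) g h :
  mx_cvg F G g -> mx_cvg F H h -> mx_cvg F (fun x => G x *m H x) (g *m h).
Proof.
move=> Gg Hh i j; under eq_fun do rewrite mxE; rewrite mxE.
by apply: cvg_finsum => k; exact: cvgM.
Qed.

Lemma mx_cvg_tr (m n : nat) (G : T -> 'M[R]_(m, n)) g :
  mx_cvg F G g -> mx_cvg F (fun x => (G x)^T) g^T.
Proof.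
by move=> Gg i j; under eq_fun do rewrite mxE; rewrite mxE; exact: Gg.
Qed.

Lemma mx_cvg_diag (n : nat) (G : T -> 'rV[R]_n) g :
  mx_cvg F G g -> mx_cvg F (fun x => diag_mx (G x)) (diag_mx g).
Proof.
move=> Gg i j; under eq_fun do rewrite mxE; rewrite mxE.
by case: eqP => _; rewrite ?mulr1n ?mulr0n; [exact: Gg | exact: cvg_cst].
Qed.

Lemma mx_cvg_trace (n : nat) (G : T -> 'M[R]_n) g :
  mx_cvg F G g -> \tr (G x) @[x --> F] --> \tr g.
Proof. by move=> Gg; exact: cvg_finsum. Qed.

Lemma mx_cvg_det (n : nat) (G : T -> 'M[R]_n) g :
  mx_cvg F G g -> \det (G x) @[x --> F] --> \det g.
Proof.
move=> Gg; apply: cvg_finsum => s; apply: cvgM; first exact: cvg_cst.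
by apply: cvg_finprod => i; exact: Gg.
Qed.

Lemma mx_cvg_unique (m n : nat) (G : T -> 'M[R]_(m, n)) g h :
  mx_cvg F G g -> mx_cvg F G h -> g = h.
Proof.
move=> Gg Gh; apply/matrixP => i j.
exact: (cvg_unique (@Rhausdorff R) (Gg i j) (Gh i j)).
Qed.

Lemma mx_cvg_frame (n : nat) (L : T -> 'M[R]_n) (d : T -> 'rV[R]_n)
    (G : T -> 'M[R]_n) l e g :
  (forall x, frame (L x) (d x) (G x)) ->
  mx_cvg F L l -> mx_cvg F d e -> mx_cvg F G g -> frame l e g.
Proof.
move=> fr Ll de Gg; have GT := mx_cvg_tr Gg; split.
  have := mx_cvg_mul Gg GT; under [fun x => _]eq_fun do rewrite (fr _).1.
  by move/mx_cvg_unique; apply; exact: mx_cvg_cst.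
have := mx_cvg_mul (mx_cvg_mul Gg Ll) GT.
under [fun x => _]eq_fun do rewrite (fr _).2.
by move/mx_cvg_unique; apply; exact: mx_cvg_diag.
Qed.

End MxCvg.

(** Frames form a compact set: a maximizing sequence has bounded entries, and its ultrafilter limit
    is again a frame because the frame equations are closed conditions. *)
Lemma nearest_frame_exists (R : realType) (n : nat) (L : 'M[R]_n)
    (d : 'rV[R]_n) (g h0 : 'M[R]_n) :
  frame L d h0 -> exists h, nearest_frame L d g h.
Proof.
move=> fh0; pose E := [set x : R | exists2 h, frame L d h & x = \tr (h *m g^T)].
have supE : has_sup E.
  split; first by exists (\tr (h0 *m g^T)), h0.
  exists (\sum_(i < n) \sum_(j < n) `|g i j|) => _ [h [hh _] ->].
  apply: (le_trans (ler_norm _)); apply: (le_trans (ler_norm_sum _ _ _)).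
  apply: ler_sum => i _; rewrite mxE.
  apply: (le_trans (ler_norm_sum _ _ _)); apply: ler_sum => j _.
  by rewrite mxE normrM ler_piMl // orthogonal_entry_le1.
have near_sup (k : nat) :
    {h : 'M[R]_n | frame L d h & sup E - k.+1%:R^-1 <= \tr (h *m g^T)}.
  apply: cid2; have k0 : 0 < k.+1%:R^-1 :> R by rewrite invr_gt0.
  have [_ [h fh ->] /ltW hle] := sup_adherent k0 supE.
  by exists h.
pose H k := s2val (near_sup k).
have fH k : frame L d (H k) := s2valP (near_sup k).
have [U [UU oU]] := @ultraFilterLemma nat \oo _.
have [|h Hh] := @ultra_bounded_mx_cvg R nat U n n H 1 UU.
  by move=> k i j; exact: (orthogonal_entry_le1 i j (fH k).1).
have fh : frame L d h.
  by apply: (mx_cvg_frame fH) Hh; exact: mx_cvg_cst.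
exists h; split => // h' fh'.
have /le_trans : \tr (h' *m g^T) <= sup E.
  by apply: sup_upper_bound => //; exists h'.
apply; apply/ler_addgt0Pr => e e0; rewrite -lerBlDr.
have : \tr (H k *m g^T) @[k --> U] --> \tr (h *m g^T).
  by apply: mx_cvg_trace; apply: mx_cvg_mul => //; exact: mx_cvg_cst.
move/cvgr_to_ge; apply; apply: oU.
have [N _ Ne] := near_infty_natSinv_lt (PosNum e0).
exists N => // k /Ne /= ke.
by apply: le_trans (s2valP' (near_sup k)); rewrite lerB // ltW.
Qed.

(** * Parallel transport of frames *)

Lemma positive_values_bounded_below (R : realType) (I : finType) (f : I -> R) :
  exists2 e : R, 0 < e & forall i, 0 < f i -> e <= f i.
Proof.
have S0 (P : pred I) : 0 <= \sum_(i | P i && (0 < f i)) (f i)^-1.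
  by apply: sumr_ge0 => i /andP[_ /ltW]; rewrite invr_ge0.
have e0 : 0 < 1 + \sum_(i | 0 < f i) (f i)^-1 by rewrite ltr_wpDr // (S0 predT).
(* The summand 1 keeps the bound positive when no value of f is positive; otherwise each positive
   value has its reciprocal among the summands. *)
exists (1 + \sum_(i | 0 < f i) (f i)^-1)^-1; first by rewrite invr_gt0.
move=> i fi; rewrite -[leRHS]invrK lef_pV2 ?posrE ?invr_gt0 //.
rewrite (bigD1 i) //= addrCA lerDl addr_ge0 //.
rewrite (eq_bigl (fun j => (j != i) && (0 < f j))) ?S0 // => j.
by rewrite andbC.
Qed.

Section Transport.
Context (R : realType) (n : nat) (A' alpha' : 'M[R]_n) (a : R -> 'rV[R]_n).
Hypothesis A'T : A'^T = A'.
Hypothesis alpha'T : alpha'^T = alpha'.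
Hypothesis ha : forall t : R, ordered_eigenvalues (A' + t *: alpha') (a t).

Let L (t : R) : 'M[R]_n := A' + t *: alpha'.
Let c : R := entry_norm alpha'.
Let c_ge0 : 0 <= c. Proof. exact: entry_norm_ge0. Qed.

Let LB (s t : R) : L s - L t = (s - t) *: alpha'.
Proof. by rewrite /L opprD addrACA subrr add0r -scalerBl. Qed.

Lemma line_frame_exists (t : R) : exists g, frame (L t) (a t) g.
Proof.
have [_ ca] := ha t.
have LT : (L t)^T = L t by rewrite /L linearD /= linearZ /= A'T alpha'T.
by have [g gg gL] := symmetric_diagonalization LT ca; exists g.
Qed.

Lemma eigenvalue_lipschitz (s t : R) (i : 'I_n) :
  `|a s 0 i - a t 0 i| <= n%:R * c * `|s - t|.
Proof.
have [g fg] := line_frame_exists t; have [h fh] := line_frame_exists s.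
have := weyl i (ha t).1 (ha s).1 fg fh.
by rewrite LB entry_normZ [`|_| * _]mulrC mulrA.
Qed.

Lemma eigenvalue_cvg (T : Type) (F : set_system T) {FF : Filter F} (u : T -> R)
    (t : R) : u @ F --> t -> mx_cvg F (fun x => a (u x)) (a t).
Proof.
move=> ut i j; rewrite ord1; apply/cvgrPdist_le => e e0.
have k0 : 0 < n%:R * c + 1 by rewrite ltr_wpDl // mulr_ge0.
have /cvgrPdist_le/(_ _ (divr_gt0 e0 k0)) := ut.
apply: filterS => x; rewrite ler_pdivlMr // => hx.
apply: (le_trans (eigenvalue_lipschitz _ _ _)); apply: le_trans hx.
by rewrite mulrC; apply: ler_wpM2l => //; rewrite lerDl.
Qed.

(** If distinct eigenvalues at t0 are at least e apart, then within time e / (4 Lam) of t0, with Lam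
    a Lipschitz constant, each one moves by at most e / 4. Eigenvalues from different blocks thus
    stay e / 2 apart, even when taken at two different times. *)
Lemma collision_free_gap (t0 : R) : collision_free a t0 ->
  exists r e : R, [/\ 0 < r, 0 < e,
    forall s, `|s - t0| < r ->
      forall i j : 'I_n, a s 0 i = a s 0 j <-> a t0 0 i = a t0 0 j &
    forall s t, `|s - t0| < r -> `|t - t0| < r ->
      forall i j : 'I_n, a t0 0 i != a t0 0 j -> e <= `|a s 0 i - a t 0 j|].
Proof.
move=> /nbhs_ballP [r1 /= r10 cf].
have [e e0 he] := positive_values_bounded_below
  (fun ij : 'I_n * 'I_n => `|a t0 0 ij.1 - a t0 0 ij.2|).
pose Lam := n%:R * c + 1.
have Lam0 : 0 < Lam by rewrite ltr_wpDl // mulr_ge0.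
have lip s i : `|a s 0 i - a t0 0 i| <= Lam * `|s - t0|.
  apply: (le_trans (eigenvalue_lipschitz _ _ _)).
  by apply: ler_wpM2r => //; rewrite /Lam lerDl.
have e20 : 0 < e / 4 / Lam by rewrite !divr_gt0.
exists (Num.min r1 (e / 4 / Lam)), (e / 2); split.
- by rewrite lt_min r10.
- by rewrite divr_gt0.
- move=> s; rewrite lt_min => /andP[sr _]; apply: cf.
  by rewrite /= /ball /= distrC.
move=> s t; rewrite !lt_min => /andP[_ s1] /andP[_ t1] i j aij.
have := he (i, j) _; rewrite /= normr_gt0 subr_eq0 => /(_ aij) eij.
have s2 : `|a s 0 i - a t0 0 i| <= e / 4.
  apply: (le_trans (lip _ _)); rewrite mulrC -ler_pdivlMr //; exact: ltW.
have t2 : `|a t 0 j - a t0 0 j| <= e / 4.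
  apply: (le_trans (lip _ _)); rewrite mulrC -ler_pdivlMr //; exact: ltW.
have -> : a s 0 i - a t 0 j = (a t0 0 i - a t0 0 j) +
   ((a s 0 i - a t0 0 i) - (a t 0 j - a t0 0 j)) by ring.
have := lerB_normD (a t0 0 i - a t0 0 j) ((a s 0 i - a t0 0 i) - (a t 0 j - a t0 0 j)).
have := ler_normB (a s 0 i - a t0 0 i) (a t 0 j - a t0 0 j).
lra.
Qed.

(** The blocks are those of t0 throughout, so the constants are uniform in s and t. Dividing
    [frame_transition] by the gap bounds the entries outside the blocks linearly;
    [nearest_frame_block_error] squares this bound inside them. *)
Lemma local_transition_bounds (t0 : R) : collision_free a t0 ->
  exists r B C : R, [/\ 0 < r, 0 <= B, 0 <= C &
    forall s t, `|s - t0| < r -> `|t - t0| < r ->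
    forall g h, frame (L t) (a t) g -> frame (L s) (a s) h ->
    (forall i j, a t0 0 i != a t0 0 j -> `|(h *m g^T) i j| <= B * `|s - t|) /\
    (nearest_frame (L s) (a s) g h -> forall i j, a t0 0 i = a t0 0 j ->
      `|(h *m g^T - 1%:M) i j| <= C * `|s - t| ^+ 2)].
Proof.
move=> /collision_free_gap [r [e [r0 e0 pat gap]]].
have B0 : 0 <= c / e by rewrite divr_ge0 // ltW.
exists r, (c / e), (n%:R ^+ 2 * (c / e) ^+ 2); split => //.
  by rewrite mulr_ge0 // sqr_ge0.
move=> s t sr tr g h fg fh.
have off i j : a t0 0 i != a t0 0 j -> `|(h *m g^T) i j| <= c / e * `|s - t|.
  move=> aij; have ge := gap _ _ sr tr _ _ aij.
  have E : `|(h *m g^T) i j| * `|a s 0 i - a t 0 j| =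
      `|s - t| * `|(h *m alpha' *m g^T) i j|.
    rewrite -!normrM (frame_transition i j fg fh) LB -scalemxAr -scalemxAl.
    by rewrite [in LHS]mxE.
  have : `|(h *m g^T) i j| * e <= `|s - t| * c.
    apply: (@le_trans _ _ (`|(h *m g^T) i j| * `|a s 0 i - a t 0 j|)).
      exact: ler_wpM2l.
    by rewrite E; apply: ler_wpM2l => //; exact: orthogonal_mul_entry_le fh.1 fg.1.
  by rewrite -ler_pdivlMr // [c / e * _]mulrC mulrA.
split=> // nh i j aij; rewrite -mulrA -exprMn.
apply: (nearest_frame_block_error fg.1 nh); last by apply/(pat _ sr).
move=> k l kl; apply: off; apply: contra_neq kl => kl; exact/(pat _ sr).
Qed.

Lemma orthogonal_mulmx_sub1_le (M X : 'M[R]_n) (x : R) (i j : 'I_n) :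
  X *m X^T = 1%:M -> (forall k l, `|(M - 1%:M) k l| <= x) ->
  `|((M - 1%:M) *m X) i j| <= n%:R * x.
Proof.
move=> XX Mx; rewrite mxE; apply: (le_trans (ler_norm_sum _ _ _)).
apply: (@le_trans _ _ (\sum_(k < n) x)).
  apply: ler_sum => k _; rewrite normrM -[leRHS]mulr1.
  by apply: ler_pM => //; exact: orthogonal_entry_le1.
by rewrite sumr_const card_ord mulr_natl.
Qed.

(** Two passes over the chain, with P_p = G_p G_0^T. The first adds up one-step errors to a linear
    bound D p e on all entries of P_p - 1. In the second, a step changes a block entry by its own
    error C e^2 and by a cross term of size n (B + C) e D p e, and these add up to O((m e)^2). *)
Lemma chain_transition_bounds (t0 : R) : collision_free a t0 ->
  exists r C : R, [/\ 0 < r, 0 <= C &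
    forall (tau e : R) (G : nat -> 'M[R]_n) (m : nat),
    0 < e <= 1 ->
    (forall p, (p <= m)%N -> `|tau + p%:R * e - t0| < r) ->
    (forall p, frame (L (tau + p%:R * e)) (a (tau + p%:R * e)) (G p)) ->
    (forall p, nearest_frame (L (tau + p.+1%:R * e)) (a (tau + p.+1%:R * e))
       (G p) (G p.+1)) ->
    forall i j, a t0 0 i = a t0 0 j ->
      `|(G m *m (G 0)^T - 1%:M) i j| <= C * (m%:R * e) ^+ 2].
Proof.
move=> /local_transition_bounds [r [B [C [r0 B0 C0 loc]]]].
pose D := n%:R * (B + C).
have D0 : 0 <= D by rewrite mulr_ge0 // addr_ge0.
exists r, (C + n%:R * (B + C) * D); split => //.
  by rewrite addr_ge0 // mulr_ge0 // mulr_ge0 // addr_ge0.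
move=> tau e G m /andP[e0 e1] near_t0 fG nG i j aij.
have step p : tau + p.+1%:R * e - (tau + p%:R * e) = e by rewrite -natr1; ring.
have GG k : G k *m (G 0)^T *m (G k *m (G 0)^T)^T = 1%:M.
  by apply: orthogonal_mulT; [exact: (fG k).1 | exact: (fG 0).1].
have onestep p k l : (p < m)%N -> `|(G p.+1 *m (G p)^T - 1%:M) k l| <= (B + C) * e.
  move=> pm; have [off blk] := loc _ _ (near_t0 _ pm) (near_t0 _ (ltnW pm)) _ _ (fG p) (fG p.+1).
  rewrite step (gtr0_norm e0) in off blk.
  (* The assumption e <= 1 makes the quadratic block error fit into the linear bound. *)
  have Ce : C * e ^+ 2 <= C * e.
    by apply: ler_wpM2l => //; rewrite expr2 ler_piMl // ltW.
  have [kl|kl] := eqVneq (a t0 0 k) (a t0 0 l).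
    apply: (le_trans (blk (nG p) _ _ kl)); apply: (le_trans Ce).
    by rewrite mulrDl lerDr mulr_ge0 // ltW.
  have kl' : k != l by apply: contra_neq kl => ->.
  rewrite mxE [(- 1%:M) _ _]mxE [1%:M _ _]mxE (negbTE kl') mulr0n subr0.
  apply: (le_trans (off _ _ kl)); rewrite mulrDl lerDl mulr_ge0 //; exact: ltW.
have decomp p : G p.+1 *m (G 0)^T - 1%:M =
    (G p.+1 *m (G p)^T - 1%:M) *m (G p *m (G 0)^T) + (G p *m (G 0)^T - 1%:M).
  rewrite mulmxBl mul1mx addrA subrK mulmxA -(mulmxA (G p.+1)).
  by rewrite (mulmx1C (fG p).1) mulmx1.
have lip p k l : (p <= m)%N -> `|(G p *m (G 0)^T - 1%:M) k l| <= D * (p%:R * e).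
  elim: p => [|p IH] pm.
    by rewrite (fG 0).1 subrr mxE normr0 mul0r mulr0.
  rewrite decomp mxE; apply: (le_trans (ler_normD _ _)).
  apply: le_trans (lerD (orthogonal_mulmx_sub1_le (x := (B + C) * e) _ _ (GG p) _) (IH (ltnW pm))) _.
    by move=> k' l'; exact: onestep.
  by rewrite /D -natr1 le_eqVlt; apply/orP; left; apply/eqP; ring.
have decomp2 p : G p.+1 *m (G 0)^T - 1%:M =
    (G p.+1 *m (G p)^T - 1%:M) *m (G p *m (G 0)^T - 1%:M) +
    (G p.+1 *m (G p)^T - 1%:M) + (G p *m (G 0)^T - 1%:M).
  by rewrite decomp mulmxBr mulmx1 subrK.
suff H p : (p <= m)%N -> `|(G p *m (G 0)^T - 1%:M) i j| <=
    (C + n%:R * (B + C) * D) * (p%:R * e) ^+ 2 by exact: H.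
elim: p => [|p IH] pm.
  by rewrite (fG 0).1 subrr mxE normr0 mul0r expr0n /= mulr0.
have [_ blk] := loc _ _ (near_t0 _ pm) (near_t0 _ (ltnW pm)) _ _ (fG p) (fG p.+1).
rewrite step (gtr0_norm e0) in blk; have {}blk := blk (nG p) i j aij.
have cross : `|((G p.+1 *m (G p)^T - 1%:M) *m (G p *m (G 0)^T - 1%:M)) i j| <=
    n%:R * ((B + C) * e * (D * (p%:R * e))).
  rewrite mxE; apply: (le_trans (ler_norm_sum _ _ _)).
  apply: (@le_trans _ _ (\sum_(k < n) (B + C) * e * (D * (p%:R * e)))).
    apply: ler_sum => k _; rewrite normrM; apply: ler_pM => //.
      exact: onestep.
    by apply: lip; exact: ltnW.
  by rewrite sumr_const card_ord -[leLHS]mulr_natl.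
rewrite decomp2 mxE; apply: (le_trans (ler_normD _ _)).
apply: (@le_trans _ _ (n%:R * ((B + C) * e * (D * (p%:R * e))) + C * e ^+ 2 +
   (C + n%:R * (B + C) * D) * (p%:R * e) ^+ 2)).
  apply: lerD (IH (ltnW pm)); rewrite mxE.
  by apply: (le_trans (ler_normD _ _)); exact: lerD.
set K := n%:R * (B + C) * D.
have K0 : 0 <= K by rewrite !mulr_ge0 // addr_ge0.
have -> : n%:R * ((B + C) * e * (D * (p%:R * e))) = K * p%:R * e ^+ 2.
  by rewrite /K; ring.
rewrite -natr1 -subr_ge0.
have -> : (C + K) * ((p%:R + 1) * e) ^+ 2 - (K * p%:R * e ^+ 2 + C * e ^+ 2 +
   (C + K) * (p%:R * e) ^+ 2) = (2 * p%:R * C + K * p%:R + K) * e ^+ 2 by ring.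
clearbody K; rewrite mulr_ge0 ?sqr_ge0 // addr_ge0 // addr_ge0 // mulr_ge0 //.
Qed.

End Transport.

Section TransportLimit.
Context (R : realType) (n : nat) (A' alpha' : 'M[R]_n) (a : R -> 'rV[R]_n).
Hypothesis A'T : A'^T = A'.
Hypothesis alpha'T : alpha'^T = alpha'.
Hypothesis ha : forall t : R, ordered_eigenvalues (A' + t *: alpha') (a t).

Let L (t : R) : 'M[R]_n := A' + t *: alpha'.

Lemma discrete_transport_exists (tau : nat -> R) :
  exists G : nat -> 'M[R]_n,
    (forall k, frame (L (tau k)) (a (tau k)) (G k)) /\
    (forall k, nearest_frame (L (tau k.+1)) (a (tau k.+1)) (G k) (G k.+1)).
Proof.
have fr t : {g : 'M[R]_n | frame (L t) (a t) g}.
  exact/cid/(line_frame_exists A'T alpha'T ha).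
have nx g t : {h : 'M[R]_n | nearest_frame (L t) (a t) g h}.
  exact/cid/(nearest_frame_exists g (svalP (fr t))).
pose G := fix G k := if k is k'.+1 then sval (nx (G k') (tau k'.+1))
                     else sval (fr (tau 0%N)).
exists G; split; last by move=> k; exact: (svalP (nx _ _)).
by case=> [|k]; [exact: (svalP (fr _)) | exact: (svalP (nx _ _)).1].
Qed.

(** The N-th grid starts at - N, so it reaches every fixed t once N is large; from then on
    [index N t] is the last grid point at or before t. *)
Let mesh (N : nat) : R := N.+1%:R^-1.
Let grid (N k : nat) : R := - N%:R + k%:R * mesh N.
Let index (N : nat) (t : R) : nat := Num.trunc ((t + N%:R) * N.+1%:R).

Let mesh_gt0 N : 0 < mesh N. Proof. by rewrite invr_gt0. Qed.

Let mesh_le1 N : mesh N <= 1.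
Proof. by rewrite invf_le1 // ler1n. Qed.

Let mesh_cvg : mesh @ \oo --> 0. Proof. exact: cvg_harmonic. Qed.

Let grid_index (N : nat) (t : R) : - N%:R <= t ->
  grid N (index N t) <= t < grid N (index N t) + mesh N.
Proof.
move=> Nt; have N0 : 0 < N.+1%:R :> R by [].
have x0 : 0 <= (t + N%:R) * N.+1%:R.
  by apply: mulr_ge0 => //; rewrite -(opprK N%:R) subr_ge0.
have /andP[l u] := truncn_itv x0.
rewrite -/(index N t) in l u.
rewrite -ler_pdivrMr // in l; rewrite -ltr_pdivlMr // -(natr1 (index N t)) mulrDl mul1r in u.
rewrite /grid; move: l u; rewrite -/(mesh N).
by move: (mesh N) (index N t) => m k l u; apply/andP; split; lra.
Qed.

Let near_ge_oppn (t : R) : \forall N \near \oo, - N%:R <= t.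
Proof.
exists (Num.trunc `|t|).+1 => // N /= tN; rewrite lerNl.
apply: (le_trans (ler_norm _)); rewrite normrN.
by apply: (le_trans (ltW (truncnS_gt _))); rewrite ler_nat.
Qed.

(** A single ultrafilter, chosen before t, defines the limit frame at all times simultaneously. The
    estimates of the discrete chains near a collision-free time are uniform in N and survive in the
    limit. *)
Lemma transported_frame_exists : exists g : R -> 'M[R]_n,
  (forall t, frame (L t) (a t) (g t)) /\
  forall t, collision_free a t -> exists r C : R, [/\ 0 < r, 0 <= C &
    forall s, `|s - t| < r -> forall i j, a t 0 i = a t 0 j ->
      `|(g s *m (g t)^T - 1%:M) i j| <= C * `|s - t| ^+ 2].
Proof.
have [U [UU oU]] := @ultraFilterLemma nat \oo _.
have Gex N : {G : nat -> 'M[R]_n |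
    (forall k, frame (L (grid N k)) (a (grid N k)) (G k)) /\
    (forall k, nearest_frame (L (grid N k.+1)) (a (grid N k.+1)) (G k) (G k.+1))}.
  by apply: cid; exact: discrete_transport_exists.
pose G N := sval (Gex N).
have fG N k : frame (L (grid N k)) (a (grid N k)) (G N k) := (svalP (Gex N)).1 k.
have nG N k := (svalP (Gex N)).2 k : nearest_frame _ _ (G N k) (G N k.+1).
have gex t : {g : 'M[R]_n | mx_cvg U (fun N => G N (index N t)) g}.
  apply: cid; apply: (ultra_bounded_mx_cvg (b := 1)) => N i j.
  exact: (orthogonal_entry_le1 i j (fG N (index N t)).1).
pose g t := sval (gex t).
have gG t : mx_cvg U (fun N => G N (index N t)) (g t) := svalP (gex t).
have grid_cvg t : grid N (index N t) @[N --> U] --> t.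
  apply: (@cvg_trans _ (grid N (index N t) @[N --> \oo])); first exact: cvg_app oU.
  apply/cvgrPdist_le => e e0; have /cvgrPdist_le/(_ _ e0) me := mesh_cvg.
  near=> N; have /andP[l u] : grid N (index N t) <= t < grid N (index N t) + mesh N.
    by apply: grid_index; near: N; exact: near_ge_oppn.
  rewrite ger0_norm ?subr_ge0 //; apply: (@le_trans _ _ (mesh N)).
    by rewrite lerBlDl; exact: ltW.
  have : `|0 - mesh N| <= e by near: N.
  by rewrite sub0r normrN gtr0_norm.
exists g; split.
  move=> t; apply: (mx_cvg_frame (F := U) (fun N => fG N (index N t))) (gG t).
    move=> i j; rewrite /L !mxE; under eq_fun do rewrite !mxE.
    by apply: cvgD; [exact: cvg_cst | apply: cvgM => //; exact: cvg_cst].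
  exact: (eigenvalue_cvg A'T alpha'T ha).
move=> t0 /(chain_transition_bounds A'T alpha'T ha) [r [C [r0 C0 chain]]].
exists (r / 2), C; split => //; first by rewrite divr_gt0.
(* Transposing g(s) g(t)^T exchanges s and t, so t <= s may be assumed. Halving r leaves room for
   the grid points, which can lie one mesh before t. *)
suff forward s t : t <= s -> `|s - t0| < r / 2 -> `|t - t0| < r / 2 ->
    forall i j, a t0 0 i = a t0 0 j ->
    `|(g s *m (g t)^T - 1%:M) i j| <= C * `|s - t| ^+ 2.
  move=> s sr i j ij; have t0r : `|t0 - t0| < r / 2 by rewrite subrr normr0 divr_gt0.
  have [st|st] := leP t0 s; first exact: forward.
  have <- : (g t0 *m (g s)^T - 1%:M)^T = g s *m (g t0)^T - 1%:M.
    by rewrite linearB /= trmx1 trmx_mul trmxK.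
  rewrite [leLHS](_ : _ = `|(g t0 *m (g s)^T - 1%:M) j i|); last by rewrite [X in `|X|]mxE.
  by rewrite distrC; apply: forward => //; exact: ltW.
move=> ts sr tr i j ij.
have lhs : `|(G N (index N s) *m (G N (index N t))^T - 1%:M) i j| @[N --> U] -->
    `|(g s *m (g t)^T - 1%:M) i j|.
  apply: cvg_norm; rewrite [(_ - 1%:M) i j]mxE; under eq_fun do rewrite mxE.
  apply: cvgD; last exact: cvg_cst.
  exact: (mx_cvg_mul (gG s) (mx_cvg_tr (gG t))).
have rhs : C * (`|s - t| + mesh N) ^+ 2 @[N --> U] --> C * `|s - t| ^+ 2.
  have xm : `|s - t| + mesh N @[N --> U] --> `|s - t| + 0.
    apply: cvgD; first exact: cvg_cst.
    by apply: cvg_trans mesh_cvg; exact: cvg_app oU.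
  rewrite addr0 in xm; under eq_fun do rewrite expr2; rewrite expr2.
  by apply: cvgM; [exact: cvg_cst | exact: cvgM].
(* The grid points of t and s are at most s - t + [mesh N] apart; the extra mesh disappears in the
   limit. *)
apply: (ler_cvg_to lhs rhs); apply: oU; near=> N.
have tN : - N%:R <= t by near: N; exact: near_ge_oppn.
have /andP[lt ut] := grid_index tN.
have /andP[ls us] := grid_index (le_trans tN ts).
have kk : (index N t <= index N s)%N.
  by apply: le_truncn; apply: ler_wpM2r => //; rewrite lerD2r.
have mr : mesh N <= r / 2.
  near: N; have r20 : 0 < r / 2 by rewrite divr_gt0.
  have /cvgrPdist_le/(_ _ r20) := mesh_cvg; apply: filterS => N.
  by rewrite sub0r normrN gtr0_norm.
set kt := index N t in lt ut kk *; set ks := index N s in ls us kk *.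
have gridD p : grid N kt + p%:R * mesh N = grid N (p + kt).
  by rewrite /grid natrD; ring.
rewrite -(subnK kk).
apply: (le_trans (chain (grid N kt) (mesh N) (fun p => G N (p + kt)%N) (ks - kt)%N
  _ _ _ _ i j ij)).
- by rewrite mesh_gt0 mesh_le1.
- move=> p pm; rewrite gridD.
  have gle : grid N (p + kt) <= grid N ks.
    rewrite /grid lerD2l; apply: ler_wpM2r; first exact: ltW.
    by rewrite ler_nat addnC -leq_subRL.
  have gge : grid N kt <= grid N (p + kt).
    rewrite /grid lerD2l; apply: ler_wpM2r; first exact: ltW.
    by rewrite ler_nat leq_addl.
  by move: sr tr; rewrite !ltr_norml; lra.
- by move=> p; rewrite gridD; exact: fG.
- by move=> p; rewrite gridD; exact: (nG N (p + kt)%N).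
have := gridD (ks - kt)%N; rewrite subnK // => gks.
have x0 : 0 <= (ks - kt)%N%:R * mesh N by rewrite mulr_ge0 // ltW.
have y0 : 0 <= `|s - t| + mesh N by rewrite addr_ge0 // ltW.
apply: ler_wpM2l => //; rewrite ler_pXn2r ?nnegrE //.
by rewrite ger0_norm ?subr_ge0 //; lra.
Unshelve. all: by end_near.
Qed.

End TransportLimit.

(** * Derivatives along the line *)

Section Derivative.
Context (R : realType) (n : nat) (A' alpha' : 'M[R]_n) (a : R -> 'rV[R]_n).
Hypothesis A'T : A'^T = A'.
Hypothesis alpha'T : alpha'^T = alpha'.
Hypothesis ha : forall t : R, ordered_eigenvalues (A' + t *: alpha') (a t).

Let L (t : R) : 'M[R]_n := A' + t *: alpha'.

(* The condition inside the eigenvalue blocks: there the frame has no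
   infinitesimal rotation at t. *)
Definition parallel_at (g : R -> 'M[R]_n) (t : R) : Prop :=
  exists r C : R, [/\ 0 < r, 0 <= C &
    forall s, `|s - t| < r -> forall i j, a t 0 i = a t 0 j ->
      `|(g s *m (g t)^T - 1%:M) i j| <= C * `|s - t| ^+ 2].

(** Entries outside the blocks are O(|s - t|) by the gap, those inside by parallelism. The general
    filter covers both s near t and h + t with h in a punctured neighbourhood of 0. *)
Lemma transition_cvg (T : Type) (F : set_system T) {FF : Filter F} (u : T -> R)
    (g : R -> 'M[R]_n) (t : R) :
  (forall t, frame (L t) (a t) (g t)) -> collision_free a t ->
  parallel_at g t -> u @ F --> t ->
  mx_cvg F (fun x => g (u x) *m (g t)^T) 1%:M.
Proof.
move=> fg cf [r1 [C1 [r10 C10 blk]]] ut i j.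
have [r2 [B [C [r20 B0 C0 loc]]]] := local_transition_bounds A'T alpha'T ha cf.
apply/cvgrPdist_le => e e0.
have k0 : 0 < B + C1 + 1 by rewrite ltr_wpDl // addr_ge0.
have d0 : 0 < Num.min (Num.min r1 r2) (Num.min 1 (e / (B + C1 + 1))).
  by rewrite !lt_min r10 r20 ltr01 divr_gt0.
have /cvgrPdist_lt/(_ _ d0) := ut; apply: filterS => x.
rewrite distrC !lt_min => /andP[/andP[x1 x2] /andP[x3 /ltW xe]].
rewrite ler_pdivlMr // in xe.
rewrite distrC; have tt2 : `|t - t| < r2 by rewrite subrr normr0.
set y := `|u x - t| in x1 x2 x3 xe.
have y0 : 0 <= y by rewrite /y normr_ge0.
have [ij|ij] := eqVneq (a t 0 i) (a t 0 j).
  have := blk _ x1 _ _ ij; rewrite mxE [(- 1%:M) _ _]mxE -/y => /le_trans; apply.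
  apply: le_trans xe; apply: (@le_trans _ _ (C1 * y)).
    by apply: ler_wpM2l => //; rewrite expr2 ler_piMl // ltW.
  by rewrite mulrC; apply: ler_wpM2l => //; rewrite -addrA addrCA lerDl addr_ge0.
have ij' : i != j by apply: contra_neq ij => ->.
rewrite [1%:M i j]mxE (negbTE ij') subr0.
have [off _] := loc _ _ x2 tt2 _ _ (fg t) (fg (u x)).
apply: (le_trans (off _ _ ij)); apply: le_trans xe; rewrite -/y mulrC.
by apply: ler_wpM2l => //; rewrite -addrA lerDl addr_ge0.
Qed.

(** Multiplies the first row of a frame by its determinant, which is 1 or -1, to land in SO(n).
    Being diagonal, it commutes with diag a and preserves frames. For n = 0 there is no first row,
    but the determinant is 1. *)
Let orient (g : 'M[R]_n) : 'M[R]_n :=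
  diag_mx (\row_(i < n) if i == 0%N :> nat then \det g else 1).

Lemma orthogonal_det_sqr (g : 'M[R]_n) : g *m g^T = 1%:M -> \det g * \det g = 1.
Proof. by move=> /(congr1 determinant); rewrite det_mulmx det_tr det1. Qed.

Lemma oriented_frame_exists : exists g : R -> 'M[R]_n,
  [/\ forall t, special_orthogonal (g t), forall t, frame (L t) (a t) (g t) &
  forall t, collision_free a t -> parallel_at g t].
Proof.
have [g [fg blk]] := transported_frame_exists A'T alpha'T ha.
have oT t : (orient (g t))^T = orient (g t) by rewrite tr_diag_mx.
have dd t := orthogonal_det_sqr (fg t).1.
have oo t : orient (g t) *m orient (g t) = 1%:M.
  rewrite mulmx_diag; apply/matrixP => i j; rewrite !mxE.
  by case: (i == 0%N :> nat); rewrite ?dd ?mulr1.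
have od t : orient (g t) *m diag_mx (a t) = diag_mx (a t) *m orient (g t).
  by rewrite !mulmx_diag; congr diag_mx; apply/rowP => i; rewrite !mxE mulrC.
exists (fun t => orient (g t) *m g t); split.
- move=> t; split.
    by rewrite trmx_mul mulmxA -(mulmxA (orient _)) (fg t).1 mulmx1 oT oo.
  rewrite det_mulmx det_diag; have : \det (g t) = 1 \/ (0 < n)%N.
    by case: (n) (g t) => [|m] x; [left; rewrite det_mx00 | right].
  case=> [d1|n0].
    by rewrite d1 mulr1 big1 // => i _; rewrite mxE if_same.
  rewrite (bigD1 (Ordinal n0)) //= mxE /= big1 ?mulr1 ?dd // => i i0.
  rewrite mxE; case: eqP => // e; case/eqP: i0; exact/val_inj.
- move=> t; split.
    by rewrite trmx_mul mulmxA -(mulmxA (orient _)) (fg t).1 mulmx1 oT oo.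
  rewrite trmx_mul oT !mulmxA -(mulmxA _ (g t) (L t)) -(mulmxA _ _ (g t)^T) (fg t).2.
  by rewrite od -mulmxA oo mulmx1.
move=> t cf; have [r1 [C1 [r10 C10 b1]]] := blk t cf.
(* The determinant of g(s) g(t)^T is 1 or -1 and tends to 1, so det g is constant near t. The
   correction is then conjugation by a fixed diagonal matrix of signs, which keeps the block
   estimate. *)
have Mcv : mx_cvg (nbhs t) (fun s => g s *m (g t)^T) 1%:M.
  exact: (transition_cvg fg cf (blk t cf) (@cvg_id _ (nbhs t))).
have dcv : \det (g s *m (g t)^T) @[s --> t] --> \det (1%:M : 'M[R]_n).
  exact: (@mx_cvg_det R R (nbhs t) _ n (fun s => g s *m (g t)^T) 1%:M Mcv).
have /cvgrPdist_lt/(_ _ ltr01) := dcv.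
move=> /nbhs_ballP [r2 /= r20 near_det].
exists (Num.min r1 r2), C1; split => //; first by rewrite lt_min r10.
move=> s; rewrite lt_min => /andP[s1 s2] i j ij.
have dst : \det (g s) = \det (g t).
  have := near_det s; rewrite /ball /= distrC => /(_ s2).
  rewrite det1 det_mulmx det_tr; have := dd s; have := dd t.
  have pm (x : R) : x * x = 1 -> x = 1 \/ x = -1.
    by move=> /eqP; rewrite -expr2 sqrf_eq1 => /orP[] /eqP; [left | right].
  move=> /pm [->|->] /pm [->|->] //.
    by rewrite mulr1 opprK ger0_norm // => h; lra.
  by rewrite mul1r opprK ger0_norm // => h; lra.
have ost : orient (g s) = orient (g t) by rewrite /orient dst.
rewrite ost trmx_mul oT.
have -> : orient (g t) *m g s *m ((g t)^T *m orient (g t)) - 1%:M =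
    orient (g t) *m (g s *m (g t)^T - 1%:M) *m orient (g t).
  by rewrite mulmxBr mulmxBl mulmx1 oo !mulmxA.
rewrite mul_mx_diag mul_diag_mx mxE [(\matrix_(_, _) _) i j]mxE !normrM.
have n1 k : `|(\row_(i < n) (if i == 0%N :> nat then \det (g t) else 1)) 0 k| = 1 :> R.
  rewrite mxE; case: ifP => _; last by rewrite normr1.
  by apply/eqP; rewrite -sqrp_eq1 // expr2 -normrM dd normr1.
by rewrite !n1 mul1r mulr1; exact: b1.
Qed.

End Derivative.

(** * Differential calculus of matrix-valued curves *)

Lemma is_derive_quotient (R : realType) (V : normedModType R) (f : R -> V)
    (t : R) (l : V) :
  h^-1 *: (f (h + t) - f t) @[h --> 0^'] --> l -> is_derive t 1 f l.
Proof.
move=> fl.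
have E : (fun h : R => h^-1 *: ((f \o shift t) (h *: (1 : R)) - f t)) =
         (fun h => h^-1 *: (f (h + t) - f t)).
  by apply/funext => h /=; rewrite [h *: 1]mulr1.
split; first by rewrite /derivable E; apply/cvg_ex; exists l.
by rewrite /derive E; exact: cvg_lim.
Qed.

Lemma quotient_is_derive (R : realType) (V : normedModType R) (f : R -> V)
    (t : R) (l : V) :
  is_derive t 1 f l -> h^-1 *: (f (h + t) - f t) @[h --> 0^'] --> l.
Proof.
case=> df <-; rewrite /derive.
have <- : (fun h : R => h^-1 *: ((f \o shift t) (h *: (1 : R)) - f t)) =
         (fun h => h^-1 *: (f (h + t) - f t)).
  by apply/funext => h /=; rewrite [h *: 1]mulr1.
exact: df.
Qed.

Lemma is_derive_scale_cst (R : realType) (V : normedModType R) (f : R -> R)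
    (v : V) (t df : R) :
  is_derive t 1 f df -> is_derive t 1 (fun s => f s *: v) (df *: v).
Proof.
move=> /quotient_is_derive fd; apply: is_derive_quotient.
under eq_fun do rewrite -scalerBl scalerA.
exact: cvgZr_tmp.
Qed.

Lemma is_derive_finsum (R : realType) (V : normedModType R) (m : nat)
    (f : 'I_m -> R -> V) (t : R) (df : 'I_m -> V) :
  (forall i, is_derive t 1 (f i) (df i)) ->
  is_derive t 1 (fun s => \sum_i f i s) (\sum_i df i).
Proof.
move=> fd; have -> : (fun s => \sum_i f i s) = \sum_i f i.
  by apply/funext => s; rewrite fct_sumE.
exact: is_derive_sum.
Qed.

Definition mx_derive (R : realType) (m n : nat) (t : R) (G : R -> 'M[R]_(m, n))
    (dG : 'M[R]_(m, n)) : Prop :=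
  forall i j, is_derive t 1 (fun s => G s i j) (dG i j).

Lemma mx_derive_mul (R : realType) (m n p : nat) (t : R)
    (G : R -> 'M[R]_(m, n)) (H : R -> 'M[R]_(n, p)) dG dH :
  mx_derive t G dG -> mx_derive t H dH ->
  mx_derive t (fun s => G s *m H s) (dG *m H t + G t *m dH).
Proof.
move=> dg dh i j; under eq_fun do rewrite mxE.
have -> : (dG *m H t + G t *m dH) i j =
    \sum_k (G t i k * dH k j + H t k j * dG i k).
  rewrite !mxE -big_split /=; apply: eq_bigr => k _.
  by rewrite addrC [dG i k * _]mulrC.
apply: is_derive_finsum => k.
exact: (is_deriveM (f := fun s => G s i k) (g := fun s => H s k j)).
Qed.

Lemma mx_derive_cst (R : realType) (m n : nat) (t : R) (X : 'M[R]_(m, n)) :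
  mx_derive t (fun=> X) 0.
Proof. by move=> i j; rewrite mxE; exact: is_derive_cst. Qed.

Lemma mx_derive_tr (R : realType) (m n : nat) (t : R) (G : R -> 'M[R]_(m, n)) dG :
  mx_derive t G dG -> mx_derive t (fun s => (G s)^T) dG^T.
Proof.
by move=> dg i j; under eq_fun do rewrite mxE; rewrite mxE; exact: dg.
Qed.

(** At M = 1 the Leibniz rule gives W X + X W^T, which is [W, X] because W is skew. *)
Lemma mx_derive_conjugate (R : realType) (n : nat) (t : R)
    (M : R -> 'M[R]_n) (W X : 'M[R]_n) :
  M t = 1%:M -> W^T = - W -> mx_derive t M W ->
  mx_derive t (fun s => M s *m X *m (M s)^T) (commutator_mx W X).
Proof.
move=> M1 WT dM.
have := mx_derive_mul (mx_derive_mul dM (mx_derive_cst t X)) (mx_derive_tr dM).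
by rewrite M1 trmx1 mulmx0 addr0 mulmx1 mul1mx WT mulmxN.
Qed.

Lemma mx_derive_is_derive (R : realType) (m n : nat) (t : R)
    (G : R -> 'M[R]_(m, n)) dG :
  mx_derive t G dG -> is_derive t 1 G dG.
Proof.
move=> dg; rewrite [dG]matrix_sum_delta.
have -> : G = fun s => \sum_i \sum_j G s i j *: delta_mx i j.
  by apply/funext => s; exact: matrix_sum_delta.
apply: is_derive_finsum => i; apply: is_derive_finsum => j.
exact: is_derive_scale_cst.
Qed.

(** Needed for second derivatives: the formula for the first derivative must hold on a whole
    neighbourhood of t. *)
Lemma collision_free_near (R : realType) (n : nat) (a : R -> 'rV[R]_n) (t : R) :
  collision_free a t -> \forall s \near t, collision_free a s.
Proof.
move=> cf; have := nbhs_interior cf; apply: filter_app.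
near=> s => cfs; have ps : forall i j, a s 0 i = a s 0 j <-> a t 0 i = a t 0 j by near: s.
move: cfs; rewrite /collision_free /interior /=; apply: filterS => x px i j.
exact: iff_trans (px i j) (iff_sym (ps i j)).
Unshelve. all: by end_near.
Qed.

Lemma mx_derive_eq (R : realType) (m n : nat) (t : R)
    (G H : R -> 'M[R]_(m, n)) dG :
  mx_derive t G dG -> (forall s, G s = H s) -> mx_derive t H dG.
Proof. by move=> dg /funext <-. Qed.

Lemma commutator_entry (R : realType) (n : nat) (X Y : 'M[R]_n) (i k : 'I_n) :
  commutator_mx X Y i k = \sum_j (X i j * Y j k - Y i j * X j k).
Proof. by rewrite sumrB /commutator_mx !mxE. Qed.

(** * Evolution equations at a collision-free time *)

Section Evolution.
Context (R : realType) (n : nat) (A' alpha' : 'M[R]_n) (a : R -> 'rV[R]_n).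
Hypothesis A'T : A'^T = A'.
Hypothesis alpha'T : alpha'^T = alpha'.
Hypothesis ha : forall t : R, ordered_eigenvalues (A' + t *: alpha') (a t).
Variables (g : R -> 'M[R]_n) (t : R).
Hypothesis fg : forall s, frame (A' + s *: alpha') (a s) (g s).
Hypothesis cf : collision_free a t.
Hypothesis par : parallel_at a g t.

Let alpha (s : R) : 'M[R]_n := conjugate (g s) alpha'.
Let Y (s : R) : 'M[R]_n :=
  commutator_mx (conjugate (g s) (A' + s *: alpha')) (alpha s).
Let M (s : R) : 'M[R]_n := g s *m (g t)^T.

Let M_cvg : mx_cvg (0^') (fun h : R => M (h + t)) 1%:M.
Proof.
apply: (transition_cvg A'T alpha'T ha fg cf par).
rewrite -[X in _ --> X]add0r; apply: cvgD; last exact: cvg_cst.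
exact: cvg_within.
Qed.

Let M_t : M t = 1%:M. Proof. exact: (fg t).1. Qed.

Let transition (h : R) (i j : 'I_n) :
  M (h + t) i j * (a (h + t) 0 i - a t 0 j) = h * (M (h + t) *m alpha t) i j.
Proof.
rewrite (frame_transition i j (fg t) (fg (h + t))) opprD addrACA subrr add0r.
rewrite -scalerBl addrK -scalemxAr -scalemxAl mxE; congr (_ * (_ : 'M[R]_n) _ _).
by rewrite /M /alpha /conjugate !mulmxA -(mulmxA (g _)) (mulmx1C (fg t).1) mulmx1.
Qed.

Let Malpha_cvg (i j : 'I_n) :
  (M (h + t) *m alpha t) i j @[h --> 0^'] --> alpha t i j.
Proof.
have H : mx_cvg (0^') (fun h => M (h + t) *m alpha t) (1%:M *m alpha t).
  by apply: mx_cvg_mul; [exact: M_cvg | exact: mx_cvg_cst].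
by rewrite mul1mx in H; exact: H.
Qed.

(** The diagonal entry of the transition identity gives the difference quotient of a_i as (M
    alpha)_ii / M_ii, and M tends to 1. *)
Lemma eigenvalue_is_derive (i : 'I_n) :
  is_derive t 1 (fun s => a s 0 i) (alpha t i i).
Proof.
apply: is_derive_quotient.
have Mii : M (h + t) i i @[h --> 0^'] --> (1 : R).
  by have := @M_cvg i i; rewrite [1%:M i i]mxE eqxx.
rewrite -[X in _ --> X]mulr1 -[X in _ * X]invr1.
apply: (cvg_trans _ (cvgM (@Malpha_cvg i i) (cvgV (oner_neq0 R) Mii))).
apply: near_eq_cvg.
near=> h.
have h0 : h != 0 by near: h; exact: nbhs_dnbhs_neq.
have m0 : 0 < M (h + t) i i.
  by near: h; exact: (cvgr_gt (1 : R) Mii).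
rewrite /= /GRing.scale /=; apply: (mulfI h0); rewrite mulrA -transition.
by field; rewrite h0 gt_eqF.
Unshelve. all: by end_near.
Qed.

Let W : 'M[R]_n := \matrix_(i, j)
  if a t 0 i == a t 0 j then 0 else alpha t i j / (a t 0 i - a t 0 j).

Let WE i j : W i j =
  if a t 0 i == a t 0 j then 0 else alpha t i j / (a t 0 i - a t 0 j).
Proof. by rewrite [LHS]mxE. Qed.

(** Outside the blocks, the difference quotient is (M alpha)_ij / (a_i(t + h) - a_j(t)) by the
    transition identity. Inside them, the quadratic estimate of [parallel_at] makes it tend to 0. *)
Lemma transition_derive : mx_derive t M W.
Proof.
move=> i j; apply: is_derive_quotient; rewrite M_t WE.
have [aij|aij] := eqVneq (a t 0 i) (a t 0 j).
  have [r [C [r0 C0 blk]]] := par.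
  apply/cvgrPdist_le => e e0; near=> h.
  have h0 : h != 0 by near: h; exact: nbhs_dnbhs_neq.
  have hr : `|h| < r.
    by near: h; apply: dnbhs0_lt.
  have he : `|h| <= e / (C + 1).
    near: h; apply: dnbhs0_le; rewrite divr_gt0 // ltr_wpDl //.
  rewrite sub0r normrN /GRing.scale /= normrM normfV.
  rewrite ler_pdivrMl ?normr_gt0 //.
  have := blk (h + t); rewrite addrK => /(_ hr i j aij).
  rewrite mxE [(- 1%:M) i j]mxE => /le_trans; apply.
  rewrite ler_pdivlMr ?ltr_wpDl // in he.
  rewrite expr2 mulrCA; apply: ler_wpM2l => //; apply: le_trans he.
  by rewrite mulrC; apply: ler_wpM2l => //; rewrite lerDl.
have ij : i != j by apply: contra_neq aij => ->.
have aij0 : a t 0 i - a t 0 j != 0 by rewrite subr_eq0.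
have acv : a (h + t) 0 i - a t 0 j @[h --> 0^'] --> a t 0 i - a t 0 j.
  apply: cvgB; last exact: cvg_cst.
  apply: (eigenvalue_cvg A'T alpha'T ha).
  rewrite -[X in _ --> X]add0r; apply: cvgD; last exact: cvg_cst.
  exact: cvg_within.
apply: (cvg_trans _ (cvgM (@Malpha_cvg i j) (cvgV aij0 acv))).
apply: near_eq_cvg; near=> h.
have h0 : h != 0 by near: h; exact: nbhs_dnbhs_neq.
have m0 : a (h + t) 0 i - a t 0 j != 0.
  by near: h; exact: (cvgr_neq0 _ acv).
rewrite /= /GRing.scale /= [1%:M i j]mxE (negbTE ij) subr0.
apply: (mulfI h0); rewrite mulrA -transition.
by rewrite mulfK // mulrA divff // mul1r.
Unshelve. all: by end_near.
Qed.

Lemma commutator_diag_entry (i j : 'I_n) :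
  Y t i j = (a t 0 i - a t 0 j) * alpha t i j.
Proof.
have E : conjugate (g t) (A' + t *: alpha') = diag_mx (a t) := (fg t).2.
rewrite /Y /commutator_mx E mul_diag_mx mul_mx_diag.
by move: (alpha t) => B; rewrite !mxE; ring.
Qed.

Let WZ : W = - Z_mx (a t) (Y t).
Proof.
apply/matrixP => i j; rewrite WE [RHS]mxE [Z_mx _ _ _ _]mxE.
case: eqVneq => aij; first by rewrite oppr0.
rewrite opprK commutator_diag_entry; field.
by rewrite subr_eq0.
Qed.

Let alphaT s : (alpha s)^T = alpha s.
Proof. by rewrite /alpha /conjugate !trmx_mul trmxK alpha'T mulmxA. Qed.

Let alphaS s i j : alpha s i j = alpha s j i.
Proof. by rewrite -{1}(alphaT s) [LHS]mxE. Qed.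

Let WT : W^T = - W.
Proof.
apply/matrixP => i j; rewrite [LHS]mxE [RHS]mxE !WE eq_sym.
case: eqVneq => aij; first by rewrite oppr0.
by rewrite alphaS -mulrN -invrN opprB.
Qed.

Let transport_conjugate (X : 'M[R]_n) (s : R) :
  conjugate (g s) X = M s *m conjugate (g t) X *m (M s)^T.
Proof.
rewrite /M /conjugate trmx_mul trmxK !mulmxA.
rewrite -[g s *m (g t)^T *m g t]mulmxA (mulmx1C (fg t).1) mulmx1.
by rewrite -[_ *m (g t)^T *m g t]mulmxA (mulmx1C (fg t).1) mulmx1.
Qed.

Lemma alpha_derive : mx_derive t alpha (commutator_mx W (alpha t)).
Proof.
apply: (mx_derive_eq (mx_derive_conjugate (alpha t) M_t WT transition_derive)).
by move=> s; rewrite [RHS]transport_conjugate.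
Qed.

(** Conservation of momentum: [A' + s alpha', alpha'] = [A', alpha'] does not depend on s, so Y only
    moves by conjugation. *)
Let Y_conjugate s : Y s = conjugate (g s) (commutator_mx A' alpha').
Proof.
have cm X Z : conjugate (g s) X *m conjugate (g s) Z = conjugate (g s) (X *m Z).
  rewrite /conjugate !mulmxA -[_ *m (g s)^T *m g s]mulmxA.
  by rewrite (mulmx1C (fg s).1) mulmx1.
rewrite /Y /commutator_mx /alpha !cm.
have -> : conjugate (g s) (A' *m alpha' - alpha' *m A') =
    conjugate (g s) (A' *m alpha') - conjugate (g s) (alpha' *m A').
  by rewrite /conjugate mulmxBr mulmxBl.
rewrite mulmxDl mulmxDr -scalemxAl -scalemxAr /conjugate !mulmxDr !mulmxDl.
by rewrite opprD addrACA subrr addr0.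
Qed.

Lemma Y_derive : mx_derive t Y (commutator_mx (Y t) (Z_mx (a t) (Y t))).
Proof.
have -> : commutator_mx (Y t) (Z_mx (a t) (Y t)) = commutator_mx W (Y t).
  by rewrite WZ /commutator_mx mulNmx mulmxN opprK addrC.
apply: (mx_derive_eq (mx_derive_conjugate (Y t) M_t WT transition_derive)).
by move=> s; rewrite !Y_conjugate [RHS]transport_conjugate.
Qed.

(** By symmetry of alpha and skewness of W, the entry [W, alpha]_ii is twice the sum of W_ij
    alpha_ij; substitute W_ij = alpha_ij / (a_i - a_j) and alpha_ij = Y_ij / (a_i - a_j). *)
Lemma alpha_diag_is_derive (i : 'I_n) :
  is_derive t 1 (fun s => alpha s i i)
    (2 * \sum_(j < n | a t 0 j != a t 0 i)
           (Y t i j ^+ 2 / (a t 0 i - a t 0 j) ^+ 3)).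
Proof.
apply: (is_derive_eq (alpha_derive i i)).
rewrite commutator_entry mulr_sumr [RHS]big_mkcond /=; apply: eq_bigr => j _.
have -> : W j i = - W i j.
  have E : W^T i j = (- W) i j by rewrite WT.
  by rewrite [LHS]mxE [RHS]mxE in E.
rewrite [alpha t j i]alphaS WE commutator_diag_entry.
case: eqVneq => aij /=.
  by rewrite mul0r oppr0 mulr0 subrr.
field.
by rewrite subr_eq0.
Qed.

End Evolution.

(** * Collision times *)

Section CollisionTimes.
Context (R : realType) (n : nat) (A' alpha' : 'M[R]_n) (a : R -> 'rV[R]_n).
Hypothesis A'T : A'^T = A'.
Hypothesis alpha'T : alpha'^T = alpha'.
Hypothesis ha : forall t : R, ordered_eigenvalues (A' + t *: alpha') (a t).

Let L (t : R) : 'M[R]_n := A' + t *: alpha'.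

(** One representative index per distinct value, so that the cardinal counts the distinct
    eigenvalues. *)
Definition first_occurrences (d : 'rV[R]_n) : {set 'I_n} :=
  finset (fun i : 'I_n => [forall j : 'I_n, (j < i)%N ==> (d 0 j != d 0 i)]).

Lemma first_occurrences_inj (d : 'rV[R]_n) (i j : 'I_n) :
  i \in first_occurrences d -> j \in first_occurrences d ->
  d 0 i = d 0 j -> i = j.
Proof.
rewrite !inE => /forallP hi /forallP hj dij; apply/val_inj => /=.
have [ij|ji|//] := ltngtP i j.
  by have := hj i; rewrite ij dij eqxx.
by have := hi j; rewrite ji dij eqxx.
Qed.

Lemma first_occurrence_exists (d : 'rV[R]_n) (i : 'I_n) :
  exists2 j, j \in first_occurrences d & d 0 j = d 0 i.
Proof.
have [j /eqP ji jmin] := @arg_minnP _ i (fun j => d 0 j == d 0 i) (@nat_of_ord n) (eqxx _).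
exists j => //; rewrite inE; apply/forallP => k; apply/implyP => kj.
by apply: contraL kj => /eqP kj; rewrite -leqNgt; apply: jmin; rewrite kj ji.
Qed.

(** A partition that refines another one and has equally many blocks coincides with it. *)
Lemma first_occurrences_refine (d e : 'rV[R]_n) :
  (forall i j, e 0 i = e 0 j -> d 0 i = d 0 j) ->
  #|first_occurrences e| = #|first_occurrences d| ->
  forall i j, d 0 i = d 0 j -> e 0 i = e 0 j.
Proof.
move=> ed card_eq.
have sub : first_occurrences d \subset first_occurrences e.
  apply/fintype.subsetP => i; rewrite !inE => /forallP hi.
  apply/forallP => j; apply/implyP => ji; have := hi j; rewrite ji /=.
  by apply: contra_neq; exact: ed.
have /eqP E : first_occurrences d == first_occurrences e.
  by rewrite eqEcard sub card_eq leqnn.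
move=> i j dij.
have [i' i'e ei] := first_occurrence_exists e i.
have [j' j'e ej] := first_occurrence_exists e j.
have ij' : i' = j'.
  apply: (@first_occurrences_inj d); rewrite ?E //.
  by rewrite (ed _ _ ei) (ed _ _ ej).
by rewrite -ei -ej ij'.
Qed.

(** By continuity, eigenvalues distinct at t stay distinct nearby, so the partition into blocks can
    only get finer; a constant number of blocks excludes a strict refinement. *)
Lemma collision_free_of_card (t : R) :
  (\forall s \near t, #|first_occurrences (a s)| = #|first_occurrences (a t)|) ->
  collision_free a t.
Proof.
move=> card_near; have acv := eigenvalue_cvg A'T alpha'T ha (@cvg_id _ (nbhs t)).
have keep (ij : 'I_n * 'I_n) : \forall s \near t,
    a s 0 ij.1 = a s 0 ij.2 -> a t 0 ij.1 = a t 0 ij.2.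
  have [aij|aij] := eqVneq (a t 0 ij.1) (a t 0 ij.2); first by apply: (@filterE _ (nbhs t)) => s _.
  have /cvgr_neq0 : (a s 0 ij.1 - a s 0 ij.2) @[s --> t] --> a t 0 ij.1 - a t 0 ij.2.
    by apply: cvgB; exact: acv.
  rewrite subr_eq0 => /(_ aij); apply: filterS => s.
  by rewrite subr_eq0 => /eqP.
have all_keep : \forall s \near t, forall ij : 'I_n * 'I_n,
    a s 0 ij.1 = a s 0 ij.2 -> a t 0 ij.1 = a t 0 ij.2.
  exact: (@filter_forall _ _ (fun ij s => a s 0 ij.1 = a s 0 ij.2 ->
    a t 0 ij.1 = a t 0 ij.2) (nbhs t) _ keep).
apply: filterS2 card_near all_keep => s card_s ks i j.
split; first exact: (ks (i, j)).
by apply: first_occurrences_refine card_s i j => i j; exact: (ks (i, j)).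
Qed.

(** The Gram matrix of the monomials 1, x, ..., x^(m-1) evaluated at the eigenvalues with
    multiplicity: a row u, read as a polynomial, has u H u^T equal to the sum of its squared values
    at the d_i. *)
Definition hankel (m : nat) (d : 'rV[R]_n) : 'M[R]_m :=
  \matrix_(p, q) \sum_i d 0 i ^+ (p + q).

Lemma hankel_mul (m : nat) (d : 'rV[R]_n) (u : 'rV[R]_m) (q : 'I_m) :
  (u *m hankel m d) 0 q = \sum_i (rVpoly u).[d 0 i] * d 0 i ^+ q.
Proof.
have pE i : (rVpoly u).[d 0 i] = \sum_(p < m) u 0 p * d 0 i ^+ p.
  by rewrite /rVpoly horner_poly; apply: eq_bigr => p _; rewrite valK.
rewrite mxE; under eq_bigr do rewrite mxE mulr_sumr.
rewrite exchange_big /=; apply: eq_bigr => i _; rewrite pE mulr_suml.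
by apply: eq_bigr => p _; rewrite exprD mulrA.
Qed.

(** With fewer than m distinct values, the monic polynomial having them as roots has degree below m,
    and its coefficients form a null vector. *)
Lemma hankel_det_neq0 (m : nat) (d : 'rV[R]_n) :
  \det (hankel m d) != 0 -> (m <= #|first_occurrences d|)%N.
Proof.
apply: contra_neqT; rewrite -ltnNge => Fm.
pose p := \prod_(i in first_occurrences d) ('X - (d 0 i)%:P).
have sp : (size p <= m)%N by rewrite /p -big_enum size_prod_XsubC -cardE.
have p0 : p != 0 by rewrite -lead_coef_eq0 (monicP (monic_prod_XsubC _ _ _)) oner_eq0.
apply/eqP/det0P; exists (poly_rV p).
  by apply: contra_neq p0 => pv0; rewrite -(poly_rV_K sp) pv0 linear0.
apply/rowP => q; rewrite hankel_mul mxE big1 // => i _.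
have [j jF ji] := first_occurrence_exists d i.
by rewrite poly_rV_K // /p (bigD1 j) //= hornerM hornerXsubC ji subrr !mul0r.
Qed.

(** A null vector is a polynomial of size at most m whose squared values at the d_i sum to 0. It
    would vanish at m distinct points. *)
Lemma hankel_det_card (d : 'rV[R]_n) :
  \det (hankel #|first_occurrences d| d) != 0.
Proof.
set m := #|_|; apply/eqP => /eqP/det0P [u u0 uH].
have : \sum_i (rVpoly u).[d 0 i] ^+ 2 = 0.
  transitivity ((u *m hankel m d *m u^T) 0 0); last by rewrite uH mul0mx mxE.
  rewrite mxE; under [RHS]eq_bigr do rewrite hankel_mul mulr_suml.
  rewrite exchange_big /=; apply: eq_bigr => i _.
  rewrite {2}/rVpoly expr2 [X in _ * X](_ : _ = \sum_(p < m) u 0 p * d 0 i ^+ p); last first.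
    by rewrite /rVpoly horner_poly; apply: eq_bigr => p _; rewrite valK.
  rewrite mulr_sumr; apply: eq_bigr => p _.
  by rewrite mxE; ring.
move/eqP; rewrite psumr_eq0 => [/allP p0|i _]; last exact: sqr_ge0.
have rt i : root (rVpoly u) (d 0 i).
  by have := p0 i (mem_index_enum _); rewrite sqrf_eq0.
have ru : rVpoly u != 0.
  by apply: contra_neq u0 => pu; rewrite -[u]rVpolyK pu linear0.
have := @max_poly_roots _ _ [seq d 0 i | i <- enum (first_occurrences d)] ru.
rewrite size_map -cardE -/m => lt_m.
have : (m < m)%N; last by rewrite ltnn.
apply: (leq_trans (lt_m _ _)); last exact: size_poly.
  by apply/allP => _ /mapP [i _ ->]; exact: rt.
rewrite map_inj_in_uniq ?enum_uniq // => i j.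
by rewrite !mem_enum; exact: first_occurrences_inj.
Qed.

(** The ring [S] varies because powers are taken both over [R] and over polynomials in t. *)
Definition mx_power (S : nzRingType) (X : 'M[S]_n) (k : nat) : 'M[S]_n :=
  iter k (mulmx X) 1%:M.

Lemma frame_power_trace (X : 'M[R]_n) (d : 'rV[R]_n) (g : 'M[R]_n) (k : nat) :
  frame X d g -> \tr (mx_power X k) = \sum_i d 0 i ^+ k.
Proof.
move=> [gg gX].
have gk : g *m mx_power X k *m g^T = diag_mx (\row_i d 0 i ^+ k).
  elim: k => [|k IH].
    rewrite mulmx1 gg; apply/matrixP => i j; rewrite !mxE expr0.
    by case: (i == j).
  have -> : g *m mx_power X k.+1 *m g^T =
      (g *m X *m g^T) *m (g *m mx_power X k *m g^T).
    rewrite /= !mulmxA -[_ *m g^T *m g]mulmxA (mulmx1C gg) mulmx1.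
    by [].
  rewrite gX IH mulmx_diag; congr diag_mx; apply/rowP => i.
  by rewrite !mxE exprS.
have -> : \tr (mx_power X k) = \tr (g *m mx_power X k *m g^T).
  by rewrite mxtrace_mulC mulmxA (mulmx1C gg) mul1mx.
by rewrite gk mxtrace_diag; apply: eq_bigr => i _; rewrite mxE.
Qed.

(** Power sums enter as traces of powers of A' + t alpha', which are polynomial in t although the
    eigenvalues need not be. *)
Definition hankel_poly (m : nat) : {poly R} :=
  let Lp := map_mx polyC A' + 'X *: map_mx polyC alpha' in
  \det (\matrix_(p < m, q < m) \tr (mx_power Lp (p + q))).

Lemma hankel_polyE (m : nat) (t : R) :
  (hankel_poly m).[t] = \det (hankel m (a t)).
Proof.
rewrite -[LHS]/(horner_eval t _) /hankel_poly -det_map_mx; congr (\det _).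
have [g fg] := line_frame_exists A'T alpha'T ha t.
apply/matrixP => p q; rewrite !mxE -(frame_power_trace _ fg).
have Lt : map_mx (horner_eval t) (map_mx polyC A' + 'X *: map_mx polyC alpha') = L t.
  by apply/matrixP => i j; rewrite !mxE /horner_eval !hornerE.
rewrite rmorph_sum /mxtrace; apply: eq_bigr => i _.
transitivity (map_mx (horner_eval t)
    (mx_power (map_mx polyC A' + 'X *: map_mx polyC alpha') (p + q)) i i).
  by rewrite mxE.
congr (_ _ i i); elim: (p + q)%N => [|k IH] /=; first by rewrite map_mx1.
by rewrite map_mxM Lt; congr (_ *m _).
Qed.

Lemma finite_roots (p : {poly R}) : p != 0 -> finite_set [set x : R | root p x].
Proof.
move=> p0; apply: contrapT => /(infinite_set_fset (size p)) [B /= Bp pB].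
suff : (size (finmap.enum_fset B) < size p)%N by rewrite ltnNge pB.
apply: (max_poly_roots p0); last exact: finmap.fset_uniq.
by apply/allP => x xB; exact: Bp.
Qed.

Lemma finite_collision_times : finite_set [set t : R | ~ collision_free a t].
Proof.
pose Q k := `[< exists t, #|first_occurrences (a t)| = k >].
have exQ : exists k, Q k.
  by exists #|first_occurrences (a 0)|; apply/asboolP; exists 0.
have Qn k : Q k -> (k <= n)%N.
  by move=> /asboolP [t <-]; rewrite -[leqRHS]card_ord max_card.
case: (ex_maxnP exQ Qn) => m /asboolP [t1 t1m] mmax.
have p0 : hankel_poly m != 0.
  have := hankel_det_card (a t1); rewrite t1m -hankel_polyE.
  by apply: contra_neq => ->; rewrite horner0.
apply: sub_finite_set (finite_roots p0) => t /= ncf.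
apply: contrapT => /negP rt; apply: ncf; apply: collision_free_of_card.
(* The determinant gives at least m distinct eigenvalues and the maximality of m at most m. Being a
   non-root is an open condition, so the count is constant near t. *)
have card_m s : ~~ root (hankel_poly m) s -> #|first_occurrences (a s)| = m.
  rewrite rootE hankel_polyE => /hankel_det_neq0 ms.
  by apply/eqP; rewrite eqn_leq ms andbT; apply: mmax; apply/asboolP; exists s.
have pt0 : (hankel_poly m).[t] != 0 by [].
have /cvgr_neq0/(_ pt0) : (hankel_poly m).[s] @[s --> t] --> (hankel_poly m).[t].
  exact: continuous_horner.
by apply: filterS => s ps; rewrite !card_m.
Qed.

End CollisionTimes.

(** * The Hamiltonian vector field *)

Lemma phase_decomposition (R : realType) (n : nat) (u v : 'rV[R]_n) (X : 'M[R]_n) :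
  ((u, v, X) : phase R n) = \sum_i u 0 i *: d_a R i + \sum_i v 0 i *: d_alpha R i +
    \sum_i \sum_j X i j *: d_Y R i j.
Proof.
pose f1 (w : 'rV[R]_n) : phase R n := (w, 0, 0).
pose f2 (w : 'rV[R]_n) : phase R n := (0, w, 0).
pose f3 (w : 'M[R]_n) : phase R n := (0, 0, w).
have f1D : {morph f1 : x y / x + y >-> x + y}.
  by move=> x y; transitivity ((x + y, 0 + 0, 0 + 0) : phase R n); [rewrite /f1 !addr0 | by []].
have f2D : {morph f2 : x y / x + y >-> x + y}.
  by move=> x y; transitivity ((0 + 0, x + y, 0 + 0) : phase R n); [rewrite /f2 !addr0 | by []].
have f3D : {morph f3 : x y / x + y >-> x + y}.
  by move=> x y; transitivity ((0 + 0, 0 + 0, x + y) : phase R n); [rewrite /f3 !addr0 | by []].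
have f1E : \sum_i u 0 i *: d_a R i = f1 u.
  rewrite {2}[u]row_sum_delta (big_morph f1 f1D (erefl _)); apply: eq_bigr => i _.
  by transitivity ((u 0 i *: delta_mx 0 i, u 0 i *: 0, u 0 i *: 0) : phase R n); [by [] | rewrite /f1 !scaler0].
have f2E : \sum_i v 0 i *: d_alpha R i = f2 v.
  rewrite {2}[v]row_sum_delta (big_morph f2 f2D (erefl _)); apply: eq_bigr => i _.
  by transitivity ((v 0 i *: 0, v 0 i *: delta_mx 0 i, v 0 i *: 0) : phase R n); [by [] | rewrite /f2 !scaler0].
have f3E : \sum_i \sum_j X i j *: d_Y R i j = f3 X.
  rewrite {2}[X]matrix_sum_delta (big_morph f3 f3D (erefl _)); apply: eq_bigr => i _.
  rewrite (big_morph f3 f3D (erefl _)); apply: eq_bigr => j _.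
  by transitivity ((X i j *: 0, X i j *: 0, X i j *: delta_mx i j) : phase R n); [by [] | rewrite /f3 !scaler0].
rewrite f1E f2E f3E.
by transitivity ((u + 0 + 0, 0 + v + 0, 0 + 0 + X) : phase R n); [rewrite !addr0 !add0r | by []].
Qed.

(** The last two sums of the field are regrouped by (i, k): they become the terms - Z_ij Y_jk and
    Y_ij Z_jk of [Y, Z]_ik, and the excluded indices are those at which Z is 0 by definition. *)
Lemma H_h_decomposition (R : realType) (n : nat) (u v : 'rV[R]_n) (X : 'M[R]_n) :
  H_h ((u, v, X) : phase R n) = \sum_i v 0 i *: d_a R i +
    \sum_i (2 * \sum_(j < n | u 0 j != u 0 i)
              (X i j ^+ 2 / (u 0 i - u 0 j) ^+ 3)) *: d_alpha R i +
    \sum_i \sum_k commutator_mx X (Z_mx u X) i k *: d_Y R i k.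
Proof.
rewrite /H_h /= -addrA; congr (_ + _ + _).
  rewrite scaler_sumr; apply: eq_bigr => i _.
  by rewrite -scalerA; congr (_ *: _); rewrite scaler_suml.
rewrite -sumrB; apply: eq_bigr => i _.
have -> : \sum_(j < n | u 0 i != u 0 j) \sum_(k < n)
      (X i j * X j k / (u 0 i - u 0 j) ^+ 2) *: d_Y R i k =
    \sum_(k < n) (\sum_(j < n | u 0 i != u 0 j)
      X i j * X j k / (u 0 i - u 0 j) ^+ 2) *: d_Y R i k.
  by rewrite exchange_big /=; apply: eq_bigr => k _; rewrite scaler_suml.
have -> : \sum_(j < n) \sum_(k < n | u 0 j != u 0 k)
      (X i j * X j k / (u 0 j - u 0 k) ^+ 2) *: d_Y R i k =
    \sum_(k < n) (\sum_(j < n | u 0 j != u 0 k)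
      X i j * X j k / (u 0 j - u 0 k) ^+ 2) *: d_Y R i k.
  rewrite (exchange_big_dep predT) //=; apply: eq_bigr => k _.
  by rewrite scaler_suml.
rewrite -sumrB; apply: eq_bigr => k _; rewrite -scalerBl; congr (_ *: _).
rewrite commutator_entry [X in X - _ = _]big_mkcond [X in _ - X = _]big_mkcond /= -sumrB; apply: eq_bigr => j _.
rewrite ![Z_mx _ _ _ _]mxE.
by case: (eqVneq (u 0 i) (u 0 j)) => ij; case: (eqVneq (u 0 j) (u 0 k)) => jk /=; ring.
Qed.

Theorem mainTheorem6 (R : realType) (n : nat) (A' alpha' : 'M[R]_n)
    (hA' : A' \is symmetricmx) (halpha' : alpha' \is symmetricmx)
    (a : R -> 'rV[R]_n)
    (ha : forall t : R, ordered_eigenvalues (A' + t *: alpha') (a t)) :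
  finite_set [set t : R | ~ collision_free a t] /\
  exists g : R -> 'M[R]_n,
    let A := fun t : R => conjugate (g t) (A' + t *: alpha') in
    let alpha := fun t : R => conjugate (g t) alpha' in
    let Y := fun t : R => commutator_mx (A t) (alpha t) in
    let Z := fun t : R => Z_mx (a t) (Y t) in
    [/\ forall t : R, special_orthogonal (g t) /\ A t = diag_mx (a t),
        forall t : R, collision_free a t ->
          integral_curve_at (@H_h R n)
            (fun s : R => (a s, \row_(i < n) alpha s i i, Y s) : phase R n) t,
        forall t : R, collision_free a t ->
          (forall i : 'I_n,
             is_derive t (1 : R) (derive1 (fun s : R => a s 0 i))
               (2 * \sum_(j < n | a t 0 j != a t 0 i)
                      (Y t i j ^+ 2 / (a t 0 i - a t 0 j) ^+ 3))) /\
          is_derive t (1 : R) Y (commutator_mx (Y t) (Z t))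
      & forall (t : R) (i j : 'I_n), a t 0 i = a t 0 j ->
          Y t i j = 0 /\ Z t i j = 0].
Proof.
have symE (X : 'M[R]_n) : X \is symmetricmx -> X^T = X.
  by move=> /is_hermitianmxP; rewrite expr0 scale1r map_mx_id.
have A'T := symE _ hA'; have alpha'T := symE _ halpha'.
split; first exact: finite_collision_times A'T alpha'T ha.
have [g [so fg par]] := oriented_frame_exists A'T alpha'T ha.
exists g => A alpha Y Z.
have da t i : collision_free a t -> is_derive t 1 (fun s => a s 0 i) (alpha t i i).
  by move=> cf; exact: (eigenvalue_is_derive A'T alpha'T ha fg cf (par t cf)).
have dalpha t i (cf : collision_free a t) :=
  alpha_diag_is_derive A'T alpha'T ha fg cf (par t cf) i.
have dY t (cf : collision_free a t) := Y_derive A'T alpha'T ha fg cf (par t cf).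
split.
- by move=> t; split; [exact: so | exact: (fg t).2].
- move=> t cf; rewrite /integral_curve_at H_h_decomposition.
  (* Curve and field are both expanded in the coordinate fields, so derivatives are compared
     coefficient by coefficient. *)
  under eq_fun do rewrite phase_decomposition.
  apply: is_deriveD; first apply: is_deriveD.
  + apply: is_derive_finsum => i; apply: is_derive_scale_cst.
    by rewrite mxE; exact: da.
  + apply: is_derive_finsum => i; apply: is_derive_scale_cst.
    by under eq_fun do rewrite mxE; exact: dalpha.
  + apply: is_derive_finsum => i; apply: is_derive_finsum => j.
    by apply: is_derive_scale_cst; exact: dY.
- move=> t cf; split; last exact/mx_derive_is_derive/dY.
  (* Near t the first derivative of a_i is alpha_ii, so its derivative is that of alpha_ii. *)
  move=> i; apply: near_eq_is_derive (dalpha t i cf).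
  apply: filterS (collision_free_near cf) => s cfs.
  by rewrite derive1E; have [_ ->] := da s i cfs.
move=> t i j aij; split; last by rewrite [Z t i j]mxE aij eqxx.
by rewrite [Y t i j](commutator_diag_entry t fg) aij subrr mul0r.
Qed.
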